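(* Let $n\ge2$ and let $a,b$ be integers with $b\in\{-1,\dots,1-n\}$ and $a+b\in\{1,2\}$ (corresponding to $X=\mathrm{Bl}_{\mathrm{pt}}\mathbb P^n$ and $\mathcal L=\mathcal O(aH+bE)$). In $\mathbb D'=\mathbb C[z,q_1^{\pm1},q_2^{\pm1}]\langle z\delta_{q_1},z\delta_{q_2}\rangle$ let $\mathbb G'=\langle\square_e,\square_{h-e}\rangle$ with $$\square_e=(z\delta_{q_1})^n-q_1(z\delta_{q_2}-z\delta_{q_1})\prod_{\nu=1}^{-b}\bigl(-b\,z\delta_{q_1}+(a+b)z\delta_{q_2}+\nu z\bigr),$$ $$\square_{h-e}=(z\delta_{q_2})(z\delta_{q_2}-z\delta_{q_1})-q_2\prod_{\nu=1}^{a+b}\bigl(-b\,z\delta_{q_1}+(a+b)z\delta_{q_2}+\nu z\bigr),$$ and let $\widehat c_{\mathrm{top}}=-b\,z\delta_{q_1}+(a+b)\,z\delta_{q_2}$. Then $$(\mathbb G':\widehat c_{\mathrm{top}})=\langle P_0,\square_e,\square_{h-e}\rangle,$$ where $$\begin{aligned}P_0={}&-a(z\delta_{q_1})^{n-1}+(a+b)(z\delta_{q_1})^{n-2}(z\delta_{q_2})\\&-ab\,q_1(z\delta_{q_2}-z\delta_{q_1})\prod_{\nu=1}^{-b-1}\bigl(-b\,z\delta_{q_1}+(a+b)z\delta_{q_2}+\nu z\bigr)\\&-(a+b)^2q_2(z\delta_{q_1})^{n-2}\prod_{\nu=1}^{a+b-1}\bigl(-b\,z\delta_{q_1}+(a+b)z\delta_{q_2}+\nu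 z\bigr).\end{aligned}$$
   Context: $\delta_{q_i}=q_i\partial_{q_i}$; $\mathbb D'$ is the non-commutative algebra generated over $\mathbb C$ by $z,q_1^{\pm1},q_2^{\pm1},z\delta_{q_1},z\delta_{q_2}$, with $z$ central, $(z\delta_{q_i})q_j=q_j(z\delta_{q_i})+\delta_{ij}\,z\,q_j$ ($\delta_{ij}$ the Kronecker symbol), and $z\delta_{q_1},z\delta_{q_2}$ commuting. $\langle\cdot\rangle$ denotes the left ideal generated; empty products equal $1$. For a left ideal $\mathbb G'$, $(\mathbb G':\widehat c_{\mathrm{top}})$ is the left ideal of $\mathbb D'$ generated by $\{P\in\mathbb D'\mid\widehat c_{\mathrm{top}}P\in\mathbb G'\}$. (Here $E$ is the exceptional divisor, $H$ the pull-back of a hyperplane, $q_1,q_2$ correspond to the dual basis $e,h-e$ of $(H-E,H)$, and $\mathbb G'$ is the GKZ ideal with the Euler operator eliminated.) *)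

(* Defs.v *)
From HB Require Import structures.
From mathcomp Require Import all_boot all_order all_algebra.
From mathcomp Require Import boolp classical_sets reals.
From mathcomp Require Import complex monalg.

Set Implicit Arguments.
Unset Strict Implicit.
Unset Printing Implicit Defensive.

Import GRing.Theory.
Local Open Scope classical_set_scope.
Local Open Scope quotient_scope.
Local Open Scope ring_scope.

Section Ideals.
Variable A : pzRingType.

Definition is_left_ideal (I : set A) : Prop :=
  [/\ I 0, forall x y, I x -> I y -> I (x + y) & forall p x, I x -> I (p * x)].

Definition is_two_sided_ideal (I : set A) : Prop :=
  is_left_ideal I /\ forall p x, I x -> I (x * p).

Definition left_ideal (S : set A) : set A := smallest is_left_ideal S.

Definition two_sided_ideal (S : set A) : set A := smallest is_two_sided_ideal S.

Definition left_colon (G : set A) (c : A) : set A :=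
  left_ideal [set P | G (c * P)].

Lemma two_sided_idealP (S : set A) : is_two_sided_ideal (two_sided_ideal S).
Proof.
split; first split.
- by move=> I [[[]]].
- by move=> x y Sx Sy I CI; have [[[_ ID _] _] _] := CI; apply: ID;
    [exact: Sx|exact: Sy].
- by move=> p x Sx I CI; have [[[_ _ IM] _] _] := CI; apply: IM; exact: Sx.
- by move=> p x Sx I CI; have [[_ IM] _] := CI; apply: IM; exact: Sx.
Qed.

End Ideals.

(* The index i : 'I_2 is shifted: ord0 stands for 1 and ord_max for 2. *)
Inductive gen := Gz | Gq of 'I_2 | Gqinv of 'I_2 | Gzdelta of 'I_2.

Definition gen_code (g : gen) : unit + ('I_2 + ('I_2 + 'I_2)) :=
  match g with
  | Gz => inl tt
  | Gq i => inr (inl i)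
  | Gqinv i => inr (inr (inl i))
  | Gzdelta i => inr (inr (inr i))
  end.

Definition gen_decode (c : unit + ('I_2 + ('I_2 + 'I_2))) : gen :=
  match c with
  | inl _ => Gz
  | inr (inl i) => Gq i
  | inr (inr (inl i)) => Gqinv i
  | inr (inr (inr i)) => Gzdelta i
  end.

Lemma gen_codeK : cancel gen_code gen_decode.
Proof. by case. Qed.

HB.instance Definition _ := Choice.copy gen (can_type gen_codeK).

Section Presentation.
Variable K : fieldType.

Local Notation free_alg := {malg K[{fmonom gen}]}.

Definition fgen (g : gen) : free_alg := << fmu g >>.

Inductive relator : set free_alg :=
| rel_z_central g : relator (fgen Gz * fgen g - fgen g * fgen Gz)
| rel_q_comm i j : relator (fgen (Gq i) * fgen (Gq j) - fgen (Gq j) * fgen (Gq i))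
| rel_q_qinv i : relator (fgen (Gq i) * fgen (Gqinv i) - 1)
| rel_qinv_q i : relator (fgen (Gqinv i) * fgen (Gq i) - 1)
| rel_zdelta_q i j :
    relator (fgen (Gzdelta i) * fgen (Gq j)
             - (fgen (Gq j) * fgen (Gzdelta i)
                + (i == j)%:R * (fgen Gz * fgen (Gq j))))
| rel_zdelta_comm i j :
    relator (fgen (Gzdelta i) * fgen (Gzdelta j)
             - fgen (Gzdelta j) * fgen (Gzdelta i)).

Definition rel_ideal : free_alg -> bool :=
  fun x => `[< two_sided_ideal relator x >].

Lemma rel_idealP x : reflect (two_sided_ideal relator x) (x \in rel_ideal).
Proof. exact: asboolP. Qed.

Lemma rel_idealMl p x : x \in rel_ideal -> p * x \in rel_ideal.
Proof.
have [[_ _ IM] _] := two_sided_idealP relator.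
by move=> /rel_idealP Ix; apply/rel_idealP; apply: IM Ix.
Qed.

Lemma rel_idealMr p x : x \in rel_ideal -> x * p \in rel_ideal.
Proof.
have [_ IM] := two_sided_idealP relator.
by move=> /rel_idealP Ix; apply/rel_idealP; apply: IM Ix.
Qed.

Lemma rel_ideal_zmod_closed : zmod_closed rel_ideal.
Proof.
have [[I0 ID IM] _] := two_sided_idealP relator.
split=> [|x y /rel_idealP Ix /rel_idealP Iy]; apply/rel_idealP => //.
by apply: ID => //; rewrite -mulN1r; apply: IM.
Qed.

HB.instance Definition _ :=
  GRing.isZmodClosed.Build free_alg rel_ideal rel_ideal_zmod_closed.

(* The ring quotient of ring_quotient.v is limited to commutative rings:
   only its Z-module quotient is used, and the product is added below. *)
Definition Dalg : Type :=
  Quotient.quot (GRing.ZmodClosed.clone free_alg rel_ideal _).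
HB.instance Definition _ := GRing.Zmodule.on Dalg.
HB.instance Definition _ := EqQuotient.on Dalg.

Definition Dpi (x : free_alg) : Dalg := \pi_Dalg x.

Lemma DpiP x y : reflect (Dpi x = Dpi y) (x - y \in rel_ideal).
Proof. by rewrite Quotient.idealrBE; exact: eqP. Qed.

Lemma DpiK (x : Dalg) : Dpi (repr x) = x.
Proof. exact: reprK. Qed.

Lemma Dpi_is_zmod_morphism : zmod_morphism Dpi.
Proof. by move=> x y; rewrite /Dpi !piE. Qed.

HB.instance Definition _ :=
  GRing.isZmodMorphism.Build free_alg Dalg Dpi Dpi_is_zmod_morphism.

Definition Dmul (x y : Dalg) : Dalg := Dpi (repr x * repr y).
Definition Dscale (c : K) (x : Dalg) : Dalg := Dpi (c *: repr x).

Lemma Dpi_mul x y : Dmul (Dpi x) (Dpi y) = Dpi (x * y).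
Proof.
apply/DpiP; rewrite -[X in X - _](subrK (x * repr (Dpi y))) -mulrBl -addrA.
rewrite -mulrBr rpredD //.
  by apply: rel_idealMr; apply/DpiP; rewrite DpiK.
by apply: rel_idealMl; apply/DpiP; rewrite DpiK.
Qed.

Lemma Dpi_scale c x : Dscale c (Dpi x) = Dpi (c *: x).
Proof.
apply/DpiP; rewrite -scalerBr -[_ - x]mul1r scalerAl.
by apply: rel_idealMl; apply/DpiP; rewrite DpiK.
Qed.

Lemma DmulA : associative Dmul.
Proof.
by move=> x y z; rewrite -(DpiK x) -(DpiK y) -(DpiK z) !Dpi_mul mulrA.
Qed.

Lemma Dmul1l : left_id (Dpi 1) Dmul.
Proof. by move=> x; rewrite -(DpiK x) Dpi_mul mul1r. Qed.

Lemma Dmul1r : right_id (Dpi 1) Dmul.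
Proof. by move=> x; rewrite -(DpiK x) Dpi_mul mulr1. Qed.

Lemma DmulDl : left_distributive Dmul +%R.
Proof.
move=> x y z; rewrite -(DpiK x) -(DpiK y) -(DpiK z) -raddfD !Dpi_mul mulrDl.
exact: raddfD.
Qed.

Lemma DmulDr : right_distributive Dmul +%R.
Proof.
move=> x y z; rewrite -(DpiK x) -(DpiK y) -(DpiK z) -raddfD !Dpi_mul mulrDr.
exact: raddfD.
Qed.

Lemma free_scaleAr (c : K) (x y : free_alg) : c *: (x * y) = x * (c *: y).
Proof.
suff Cc : c%:MP * x = x * c%:MP by rewrite -!mul_malgC !mulrA Cc.
rewrite mul_malgC {1}(monalgE x) scaler_sumr [RHS]fgmulgU.
by apply: eq_bigr => k _; rewrite -mul_malgC malgM_def fgmulUU mul1m mulm1 mulrC.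
Qed.

(* Nontriviality: the character z, z delta_i |-> 0, q_i^{+-1} |-> 1. *)
Definition gen_char (g : gen) : K :=
  match g with Gz | Gzdelta _ => 0 | Gq _ | Gqinv _ => 1 end.

Definition fmonom_char (m : {fmonom gen}) : K :=
  \prod_(g <- (m : seq gen)) gen_char g.

Lemma fmonom_char_mmorphism : mmorphism fmonom_char.
Proof.
split=> [x y|]; rewrite /fmonom_char ?fm1 ?big_nil //.
by rewrite fmM big_cat.
Qed.

HB.instance Definition _ :=
  isMultiplicative.Build {fmonom gen} K fmonom_char fmonom_char_mmorphism.

Definition free_char : free_alg -> K := mmap idfun fmonom_char.

Lemma free_charM : {morph free_char : x y / x * y}.
Proof. exact: (mmap_is_multiplicative (f := idfun)).1. Qed.

Lemma free_charB : {morph free_char : x y / x - y}.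
Proof. exact: mmapB. Qed.

Lemma free_charD : {morph free_char : x y / x + y}.
Proof. exact: mmapD. Qed.

Lemma free_char1 : free_char 1 = 1.
Proof. exact: mmap1. Qed.

Lemma free_char_gen g : free_char (fgen g) = gen_char g.
Proof. by rewrite /free_char mmapU mul1r /= /fmonom_char fmU big_seq1. Qed.

Lemma rel_ideal_char x : x \in rel_ideal -> free_char x = 0.
Proof.
move=> /rel_idealP; apply: (@smallest_sub _ _ _ [set y | free_char y = 0]).
  split; first split=> [|y z /= y0 z0|p y /= y0].
  - exact: mmap0.
  - by rewrite free_charD y0 z0 addr0.
  - by rewrite free_charM y0 mulr0.
  - by move=> p y /= y0; rewrite free_charM y0 mul0r.
have comm0 y t : free_char (y * t - t * y) = 0.
  by rewrite free_charB (free_charM y) (free_charM t) mulrC subrr.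
have inv0 y t : free_char y = 1 -> free_char t = 1 -> free_char (y * t - 1) = 0.
  by move=> y1 t1; rewrite free_charB free_charM free_char1 y1 t1 mulr1 subrr.
have zd0 y t u v : free_char y = 0 -> free_char v = 0 ->
    free_char (y * t - (t * y + u * (v * t))) = 0.
  move=> y0 v0; rewrite free_charB free_charD !free_charM y0 v0.
  by rewrite !mul0r !mulr0 addr0 subrr.
move=> _ [g|i j|i|i|i j|i j].
- exact: comm0.
- exact: comm0.
- by apply: inv0; rewrite free_char_gen.
- by apply: inv0; rewrite free_char_gen.
- by apply: zd0; rewrite free_char_gen.
- exact: comm0.
Qed.

Lemma Dalg1_neq0 : Dpi 1 != 0.
Proof.
rewrite -(raddf0 Dpi); apply/eqP => /DpiP; rewrite subr0 => /rel_ideal_char.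
by rewrite free_char1; apply/eqP/oner_neq0.
Qed.

HB.instance Definition _ := GRing.Zmodule_isNzRing.Build Dalg
  DmulA Dmul1l Dmul1r DmulDl DmulDr Dalg1_neq0.

Lemma DscaleA a b x : Dscale a (Dscale b x) = Dscale (a * b) x.
Proof. by rewrite -(DpiK x) !Dpi_scale scalerA. Qed.

Lemma Dscale1 : left_id 1 Dscale.
Proof. by move=> x; rewrite -(DpiK x) Dpi_scale scale1r. Qed.

Lemma DscaleDr : right_distributive Dscale +%R.
Proof.
move=> a x y; rewrite -(DpiK x) -(DpiK y) -raddfD !Dpi_scale scalerDr.
exact: raddfD.
Qed.

Lemma DscaleDl x : {morph Dscale^~ x : a b / a + b}.
Proof.
by move=> a b; rewrite -(DpiK x) !Dpi_scale scalerDl; exact: raddfD.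
Qed.

HB.instance Definition _ := GRing.Zmodule_isLmodule.Build K Dalg
  DscaleA Dscale1 DscaleDr DscaleDl.

Lemma DscaleAl (a : K) (x y : Dalg) : a *: (x * y) = (a *: x) * y.
Proof.
rewrite -(DpiK x) -(DpiK y).
change (Dscale a (Dmul (Dpi (repr x)) (Dpi (repr y)))
        = Dmul (Dscale a (Dpi (repr x))) (Dpi (repr y))).
by rewrite Dpi_mul !Dpi_scale Dpi_mul scalerAl.
Qed.

HB.instance Definition _ := GRing.Lmodule_isLalgebra.Build K Dalg DscaleAl.

Lemma DscaleAr (a : K) (x y : Dalg) : a *: (x * y) = x * (a *: y).
Proof.
rewrite -(DpiK x) -(DpiK y).
change (Dscale a (Dmul (Dpi (repr x)) (Dpi (repr y)))
        = Dmul (Dpi (repr x)) (Dscale a (Dpi (repr y)))).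
by rewrite Dpi_mul !Dpi_scale Dpi_mul free_scaleAr.
Qed.

HB.instance Definition _ := GRing.Lalgebra_isAlgebra.Build K Dalg DscaleAr.

Definition zD : Dalg := Dpi (fgen Gz).
Definition qD (i : 'I_2) : Dalg := Dpi (fgen (Gq i)).
Definition qinvD (i : 'I_2) : Dalg := Dpi (fgen (Gqinv i)).
Definition zdD (i : 'I_2) : Dalg := Dpi (fgen (Gzdelta i)).

End Presentation.

Section GKZ.
Variables (K : fieldType) (n : nat) (a b : int).

Local Notation D := (Dalg K).
Local Notation z := (zD K).
Local Notation q1 := (qD K ord0).
Local Notation q2 := (qD K ord_max).
Local Notation zd1 := (zdD K ord0).
Local Notation zd2 := (zdD K ord_max).

Definition ctop : D := (- b)%:~R * zd1 + (a + b)%:~R * zd2.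

(* The product over nu = 1, ..., m; it is empty when m <= 0. *)
Definition ctop_prod (m : int) : D :=
  if m is Posz k then \prod_(1 <= nu < k.+1) (ctop + nu%:R * z) else 1.

Definition box_e : D :=
  zd1 ^+ n - q1 * (zd2 - zd1) * ctop_prod (- b).

Definition box_he : D :=
  zd2 * (zd2 - zd1) - q2 * ctop_prod (a + b).

Definition P0 : D :=
  - a%:~R * zd1 ^+ (n - 1) + (a + b)%:~R * zd1 ^+ (n - 2) * zd2
  - (a * b)%:~R * q1 * (zd2 - zd1) * ctop_prod (- b - 1)
  - (a + b)%:~R ^+ 2 * q2 * zd1 ^+ (n - 2) * ctop_prod (a + b - 1).

Definition GKZ_ideal : set D := left_ideal [set box_e; box_he].

End GKZ.

Arguments GKZ_ideal : clear implicits.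

(* Main.v *)
(** Write [x = z delta_{q_1}], [y = z delta_{q_2}], [beta = - b], [s = a + b] and
[c = beta x + s y].  As a left module over the Laurent monomials, the algebra
is the direct sum of the [q^m C[z, x, y]], and [c q^m = q^m (c + l(m) z)] with
[l(m) = beta m_1 + s m_2].  A direct computation gives
[c P0 = - a beta box_e + s^2 x^(n-2) box_he], so [P0] lies in the colon ideal.

Conversely let [c P = A box_e + B box_he].  Modulo [c] on the left, [A] and [B]
become finite sums of terms [q^m p] with [p] in [C[z, x]].  Consider an exponent
[m] of minimal total degree, with coefficients [al], [be].  Comparing the
[q^m]-components modulo [c + l(m) z], that is at the value [y_0] of [y] which
annihilates it, gives [al x^n + be y_0 (y_0 - x) = 0].  If [l(m) = 0], the term
is a multiple of [c P0].  Otherwise [y_0 (y_0 - x)] is coprime to [x], hence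
[be = x^n f] and [al = - f y_0 (y_0 - x)], and the Koszul syzygy between the two
boxes replaces the term by terms at [q_1 q^m] and [q_2 q^m] whose coefficients
have smaller degree in [x], up to left multiples of [c].  The procedure
terminates, and [c] is not a left zero divisor. *)

Require Import Defs.
From mathcomp Require Import all_boot all_order all_algebra.
From mathcomp Require Import boolp classical_sets reals complex.
From mathcomp Require Import finmap monalg.
From mathcomp Require Import zify ring.

Set Implicit Arguments.
Unset Strict Implicit.
Unset Printing Implicit Defensive.

Import Order.TTheory GRing.Theory Num.Theory.
Local Open Scope classical_set_scope.
Local Open Scope ring_scope.

(** Evaluating one more variable requires that its value commute with the image obtained so far;
    this lemma passes the condition from one polynomial layer to the next. *)
Lemma comm_horner_morph (A B : nzRingType) (f : {rmorphism A -> B}) (u t : B)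
    (cfu : commr_rmorph f u) :
  GRing.comm t u -> commr_rmorph f t -> commr_rmorph (horner_morph cfu) t.
Proof.
move=> tu tf p; rewrite /horner_morph horner_coef.
apply: commr_sum => i _; apply: commrM; last exact: commrX.
by rewrite coef_map; apply: tf.
Qed.

(** * The algebra as a sum of the modules q^m C[z, x, y] *)

(* [QM m] is [q_1^(m.1) q_2^(m.2)], and [coefM P m] is the coefficient of
   [QM m], written to its left, in [P]; the nested polynomial variables are
   [z] (innermost), [x] and [y]. *)
Record qdiff_model (K : numFieldType) (D : algType K) := QdiffModel {
  zM : D; xM : D; yM : D; QM : int * int -> D;
  zM_x : GRing.comm xM zM;
  zM_y : GRing.comm yM zM;
  xM_y : GRing.comm yM xM;
  zM_Q : forall m, zM * QM m = QM m * zM;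
  xM_Q : forall m, xM * QM m = QM m * (xM + m.1%:~R * zM);
  yM_Q : forall m, yM * QM m = QM m * (yM + m.2%:~R * zM);
  QM0 : QM 0 = 1;
  QMD : forall m k, QM (m + k) = QM m * QM k;
  M_ind : forall S : D -> Prop,
    S 1 -> (forall P P', S P -> S P' -> S (P + P')) ->
    (forall (k : K) P, S P -> S (k *: P)) ->
    (forall P, S P -> S (zM * P)) -> (forall P, S P -> S (xM * P)) ->
    (forall P, S P -> S (yM * P)) -> (forall m P, S P -> S (QM m * P)) ->
    forall P, S P;
  coefM : D -> int * int -> {poly {poly {poly K}}};
  coefMD : forall P P' m, coefM (P + P') m = coefM P m + coefM P' m;
  coefMZ : forall k P m, coefM (k *: P) m = k%:P%:P%:P * coefM P m;
  coefM1 : forall m, coefM 1 m = (m == 0)%:R;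
  coefMz : forall P m, coefM (zM * P) m = 'X%:P%:P * coefM P m;
  coefMx : forall P m,
    coefM (xM * P) m = ('X%:P + m.1%:~R * 'X%:P%:P) * coefM P m;
  coefMy : forall P m,
    coefM (yM * P) m = ('X + m.2%:~R * 'X%:P%:P) * coefM P m;
  coefMQ : forall k P m, coefM (QM k * P) m = coefM P (m - k)
}.

Section Model.
Variables (K : numFieldType) (D : algType K) (M : qdiff_model D).

Local Notation z := (zM M).
Local Notation x := (xM M).
Local Notation y := (yM M).
Local Notation Q := (QM M).
Local Notation K1 := {poly K}.
Local Notation K2 := {poly {poly K}}.
Local Notation K3 := {poly {poly {poly K}}}.

(** The variables are evaluated one after the other, which is possible because [z], [x] and [y]
    commute. Sealing the construction leaves only its four values visible. *)
Fact ev_subproof : {f : {rmorphism K3 -> D} |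
  [/\ forall k, f k%:P%:P%:P = k%:A, f 'X%:P%:P = z, f 'X%:P = x & f 'X = y]}.
Proof.
pose f1 : {rmorphism K1 -> D} := horner_alg z.
have f1C t : GRing.comm t z -> commr_rmorph f1 t.
  move=> tz; apply: comm_horner_morph => // k.
  exact/commr_sym/comm_alg.
pose f2 : {rmorphism K2 -> D} := horner_morph (f1C _ (zM_x M)).
have f2C : commr_rmorph f2 y.
  by apply: comm_horner_morph (xM_y M) _; exact (f1C y (zM_y M)).
exists (horner_morph f2C : {rmorphism K3 -> D}); split=> [k|||].
- exact: etrans (horner_morphC f2C _) (etrans (horner_morphC _ _) (horner_algC _ _)).
- exact: etrans (horner_morphC f2C _) (etrans (horner_morphC _ _) (horner_algX _)).
- exact: etrans (horner_morphC f2C _) (horner_morphX _).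
- exact: horner_morphX.
Qed.

Definition ev : {rmorphism K3 -> D} := sval ev_subproof.

Lemma ev_C k : ev k%:P%:P%:P = k%:A.
Proof. by rewrite /ev; case: ev_subproof => f []. Qed.

Lemma ev_z : ev 'X%:P%:P = z.
Proof. by rewrite /ev; case: ev_subproof => f []. Qed.

Lemma ev_x : ev 'X%:P = x.
Proof. by rewrite /ev; case: ev_subproof => f []. Qed.

Lemma ev_y : ev 'X = y.
Proof. by rewrite /ev; case: ev_subproof => f []. Qed.

Lemma coefM0 m : coefM M 0 m = 0.
Proof. by rewrite -(scale0r 0) coefMZ !polyC0 mul0r. Qed.

Lemma coefM_sum (I : Type) (r : seq I) (F : I -> D) m :
  coefM M (\sum_(i <- r) F i) m = \sum_(i <- r) coefM M (F i) m.
Proof.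
apply: (big_morph (fun P => coefM M P m)) => [P P'|]; first exact: coefMD.
exact: coefM0.
Qed.

Lemma coefM_ev g m : coefM M (ev g) m = (m == 0)%:R * g.
Proof.
have E1 (p : K1) : coefM M (ev p%:P%:P) m = (m == 0)%:R * p%:P%:P.
  elim/poly_ind: p => [|p k IH]; first by rewrite !polyC0 rmorph0 coefM0 mulr0.
  rewrite mulrC !polyCD !polyCM rmorphD rmorphM ev_z ev_C coefMD coefMz IH.
  by rewrite coefMZ coefM1; ring.
have E2 (p : K2) : coefM M (ev p%:P) m = (m == 0)%:R * p%:P.
  elim/poly_ind: p => [|p k IH]; first by rewrite polyC0 rmorph0 coefM0 mulr0.
  rewrite mulrC polyCD polyCM rmorphD rmorphM ev_x coefMD coefMx IH E1.
  case: eqP => [->|_] /=; first by ring.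
  by rewrite !mul0r mulr0 addr0.
elim/poly_ind: g => [|p k IH]; first by rewrite rmorph0 coefM0 mulr0.
rewrite mulrC rmorphD rmorphM ev_y coefMD coefMy IH E2.
case: eqP => [->|_] /=; first by ring.
by rewrite !mul0r mulr0 addr0.
Qed.

Lemma coefM_Qev k g m : coefM M (Q k * ev g) m = (m == k)%:R * g.
Proof. by rewrite coefMQ coefM_ev subr_eq0. Qed.

(** Sums of this form are stable under left multiplication by each generator, since a generator
    passes [Q m] at the price of a shift. *)
Lemma span_Qev P : exists s : seq ((int * int) * K3),
  P = \sum_(e <- s) Q e.1 * ev e.2.
Proof.
elim/(@M_ind _ _ M): P.
- exists [:: (0, 1)]; rewrite big_seq1 /= QM0 rmorph1 mulr1 //.
- move=> _ _ [s ->] [t ->]; exists (s ++ t); by rewrite big_cat.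
- move=> k _ [s ->]; exists [seq (e.1, k%:P%:P%:P * e.2) | e <- s].
  rewrite big_map scaler_sumr; apply: eq_bigr => e _ /=.
  by rewrite rmorphM ev_C mulr_algl scalerAr.
- move=> _ [s ->]; exists [seq (e.1, 'X%:P%:P * e.2) | e <- s].
  rewrite big_map mulr_sumr; apply: eq_bigr => e _ /=.
  by rewrite rmorphM ev_z !mulrA zM_Q.
- move=> _ [s ->].
  exists [seq (e.1, ('X%:P + e.1.1%:~R * 'X%:P%:P) * e.2) | e <- s].
  rewrite big_map mulr_sumr; apply: eq_bigr => e _ /=.
  by rewrite rmorphM rmorphD rmorphM rmorph_int ev_x ev_z !mulrA xM_Q.
- move=> _ [s ->].
  exists [seq (e.1, ('X + e.1.2%:~R * 'X%:P%:P) * e.2) | e <- s].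
  rewrite big_map mulr_sumr; apply: eq_bigr => e _ /=.
  by rewrite rmorphM rmorphD rmorphM rmorph_int ev_y ev_z !mulrA yM_Q.
- move=> m _ [s ->]; exists [seq (m + e.1, e.2) | e <- s].
  rewrite big_map mulr_sumr; apply: eq_bigr => e _ /=.
  by rewrite QMD mulrA.
Qed.

Lemma coefM_eq0 P : (forall m, coefM M P m = 0) -> P = 0.
Proof.
(* An exponent may occur several times in [s]; [t] lists each once, and [P] is rebuilt from its
   coefficients along [t]. *)
have [s ->] := span_Qev P; set t := undup (map fst s) => P0.
transitivity (\sum_(m <- t) Q m * ev (coefM M (\sum_(e <- s) Q e.1 * ev e.2) m));
  last by rewrite big1 // => m _; rewrite P0 rmorph0 mulr0.
transitivity (\sum_(m <- t) \sum_(e <- s) Q m * ev ((m == e.1)%:R * e.2)); last first.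
  apply: eq_bigr => m _; rewrite coefM_sum rmorph_sum /= mulr_sumr.
  by apply: eq_bigr => e _; rewrite coefM_Qev.
rewrite exchange_big /=; apply: eq_big_seq => e es.
have et : e.1 \in t by rewrite mem_undup map_f.
rewrite (bigD1_seq e.1) ?undup_uniq //= eqxx mul1r big1 ?addr0 // => m /negPf->.
by rewrite mul0r rmorph0 mulr0.
Qed.

End Model.

(** * The boxes, P0 and the Koszul syzygy *)

(** Induction step for moving a polynomial past [q]: [poly_ind] produces the shape [a * v + b]. *)
Lemma twist_MD (C D : nzRingType) (f : {rmorphism C -> D}) (q : D)
    (a a' b b' v v' : C) :
  f a * q = q * f a' -> f b * q = q * f b' -> f v * q = q * f v' ->
  f (a * v + b) * q = q * f (a' * v' + b').
Proof.
move=> ha hb hv.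
by rewrite !rmorphD !rmorphM mulrDl mulrDr -mulrA hv mulrA ha hb -mulrA.
Qed.

Section Boxes.
Variables (C : comNzRingType) (D : nzRingType) (f : {rmorphism C -> D}).
Variables (X Y Z : C) (Q1 Q2 : D) (sh1 sh2 : {rmorphism C -> C}).
Hypotheses (fQ1 : forall g, f g * Q1 = Q1 * f (sh1 g))
           (fQ2 : forall g, f g * Q2 = Q2 * f (sh2 g))
           (QC : Q1 * Q2 = Q2 * Q1).
Hypotheses (sh1X : sh1 X = X + Z) (sh1Y : sh1 Y = Y) (sh1Z : sh1 Z = Z)
           (sh2X : sh2 X = X) (sh2Y : sh2 Y = Y + Z) (sh2Z : sh2 Z = Z).
Variables (N B S : nat).

Definition lform (b s : nat) : C := b%:R * X + s%:R * Y.

Local Notation c := (lform B.+1 S.+1).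

Definition rising k : C := \prod_(1 <= nu < k.+1) (c + nu%:R * Z).

(** In the parameters of the theorem, [n = N.+2], [- b = B.+1] and [a + b = S.+1]; hence
    [a = B.+1 + S.+1], and the coefficient behind [Q1] is [- a b]. *)
Definition genP0 : D :=
  f (- (B.+1 + S.+1)%:R * X ^+ N.+1 + S.+1%:R * X ^+ N * Y)
  + Q1 * f (((B.+1 + S.+1) * B.+1)%:R * (Y - X) * rising B)
  - Q2 * f (S.+1%:R ^+ 2 * X ^+ N * rising S).

Definition genbox_e : D := f (X ^+ N.+2) - Q1 * f ((Y - X) * rising B.+1).
Definition genbox_he : D := f (Y * (Y - X)) - Q2 * f (rising S.+1).

Lemma risingS k : rising k.+1 = rising k * (c + k.+1%:R * Z).
Proof. by rewrite /rising big_nat_recr. Qed.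

Lemma sh1c : sh1 c = c + B.+1%:R * Z.
Proof. rewrite /lform rmorphD !rmorphM !rmorph_nat sh1X sh1Y; ring. Qed.

Lemma sh2c : sh2 c = c + S.+1%:R * Z.
Proof. rewrite /lform rmorphD !rmorphM !rmorph_nat sh2X sh2Y; ring. Qed.

(** The shifted factors carry the numbers [i + 1] to [i + k] and so continue the first product. *)
Lemma rising_shift (sh : {rmorphism C -> C}) i k :
    sh c = c + i%:R * Z -> sh Z = Z ->
  rising i * sh (rising k) = rising (i + k).
Proof.
move=> shc shZ; elim: k => [|k IH].
  by rewrite addn0 [X in sh X]/rising big_geq // rmorph1 mulr1.
rewrite addnS !risingS -IH rmorphM rmorphD rmorphM rmorph_nat shc shZ.
rewrite -addnS natrD; ring.
Qed.

Let fQ1M g h : f g * (Q1 * f h) = Q1 * f (sh1 g * h).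
Proof. by rewrite mulrA fQ1 -mulrA -rmorphM. Qed.

Let fQ2M g h : f g * (Q2 * f h) = Q2 * f (sh2 g * h).
Proof. by rewrite mulrA fQ2 -mulrA -rmorphM. Qed.

Lemma boxes_expand p r : exists g1 g2,
  f p * genbox_e + f r * genbox_he =
  f (p * X ^+ N.+2 + r * (Y * (Y - X))) + (Q1 * f g1 + Q2 * f g2).
Proof.
exists (- (sh1 p * ((Y - X) * rising B.+1))), (- (sh2 r * rising S.+1)).
rewrite /genbox_e /genbox_he (mulrBr (f p)) (mulrBr (f r)) fQ1M fQ2M -!(rmorphM f).
by rewrite addrACA -(rmorphD f) !rmorphN !mulrN.
Qed.

(** Passing [Q1] or [Q2] turns [c] into [c + B.+1 Z] or [c + S.+1 Z], the last factor missing in the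
    products of [genP0]. In the remaining part, [a = beta + s] collects the cross terms to
    [- s^2 X^(N+1) Y]. *)
Lemma lform_genP0 : f c * genP0 =
  f (- ((B.+1 + S.+1) * B.+1)%:R) * genbox_e
  + f (S.+1%:R ^+ 2 * X ^+ N) * genbox_he.
Proof.
have e1 : sh1 c * (((B.+1 + S.+1) * B.+1)%:R * (Y - X) * rising B) =
    - (sh1 (- ((B.+1 + S.+1) * B.+1)%:R) * ((Y - X) * rising B.+1)).
  rewrite sh1c risingS rmorphN rmorph_nat; ring.
have e2 : sh2 c * (S.+1%:R ^+ 2 * X ^+ N * rising S) =
    sh2 (S.+1%:R ^+ 2 * X ^+ N) * rising S.+1.
  rewrite sh2c risingS rmorphM !rmorphXn rmorph_nat sh2X; ring.
rewrite /genP0 /genbox_e /genbox_he mulrBr mulrDr fQ1M fQ2M e1 e2.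
rewrite [in RHS]mulrBr [X in _ = _ + X]mulrBr fQ1M fQ2M rmorphN mulrN.
rewrite -!(rmorphM f) [in RHS]addrACA -[in RHS]rmorphD.
rewrite -[LHS]addrA; congr (f _ + _).
rewrite /lform !exprS; ring.
Qed.

(* The commutation of the boxes up to shifts, with [Y * (Y - X)] split as
   [u + cl * w]: for [cl = c + l(m) z], the term in [cl] becomes a left multiple
   of [c] behind [q^m]. *)
Lemma koszul F F1 u cl w : sh1 F = F1 -> sh2 F = F -> sh2 F1 = F1 ->
    Y * (Y - X) = u + cl * w ->
  f (- (F * u)) * genbox_e + f (F * X ^+ N.+2) * genbox_he =
  f (cl * (F * w)) * genbox_e
  - Q2 * f (F * rising S.+1) * genbox_e
  + Q1 * f (F1 * ((Y - X - Z) * rising B.+1)) * genbox_he.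
Proof.
move=> F1E F2E F12 YX; rewrite /genbox_e /genbox_he.
set a := F * rising _; set e := F1 * _.
set g := (Y - X) * _; set r := rising _.
set b := X ^+ _; set h := Y * _.
have E1 : - (F * u) * b + F * b * h = cl * (F * w) * b.
  by rewrite /h YX; ring.
have E2 : sh2 (F * b) * r = a * b.
  by rewrite rmorphM rmorphXn sh2X F2E /a -/r -/b; ring.
have E3 : sh1 (- (F * u)) * g = sh1 (cl * (F * w)) * g - e * h.
  have -> : - (F * u) = cl * (F * w) - F * h by rewrite /h YX; ring.
  rewrite rmorphB (rmorphM _ F) F1E /h rmorphM rmorphB sh1X sh1Y /e /g; ring.
have E4 : sh1 a * g = sh2 e * r.
  (* Both sides are [rising (B.+1 + S.+1)]; this is why the two boxes commute up to shifts. *)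
  have R : sh1 r * rising B.+1 = sh2 (rising B.+1) * r.
    by rewrite mulrC (rising_shift _ sh1c sh1Z) addnC mulrC (rising_shift _ sh2c sh2Z).
  have -> : sh1 a * g = F1 * (Y - X) * (sh1 r * rising B.+1).
    by rewrite rmorphM F1E /g; ring.
  rewrite R /e (rmorphM _ F1) F12 (rmorphM _ (Y - X - Z)) !rmorphB sh2X sh2Y sh2Z.
  ring.
have E5 : Q2 * f a * (Q1 * f g) = Q1 * f e * (Q2 * f r).
  by rewrite -!mulrA fQ1M fQ2M E4 !mulrA QC.
rewrite !mulrBr E5 !fQ1M !fQ2M E2 E3 -[Q2 * f a * _]mulrA -[Q1 * f e * f h]mulrA.
rewrite -!(rmorphM f) (rmorphB f (_ * g)) -E1 rmorphD mulrBr.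
move: (f _) (f _) (Q1 * _) (Q2 * f (a * b)) (Q1 * f (e * h)) (Q1 * f e * _).
move=> A1 A2 P T E W; rewrite !opprB addrACA -!addrA; do 2!congr (_ + _).
rewrite [W + _]addrC -!addrA addNr addr0 [in RHS]addrA [RHS]addrC.
by rewrite addrA.
Qed.

End Boxes.

(** * Reduction modulo c *)

Section Shift.
Variable R : comNzRingType.
Local Notation K3 := {poly {poly {poly R}}}.
Variable m : int * int.

(** [shift2 m] substitutes [x + m.1 z] for [x], and [shift m] below also [y + m.2 z] for [y]: the
    effect of moving a polynomial past [q^m]. *)
Fact shift2_subproof : {f : {rmorphism {poly {poly R}} -> {poly {poly R}}} |
  f =1 comp_poly ('X + (m.1%:~R * 'X)%:P)}.
Proof. by exists (comp_poly ('X + (m.1%:~R * 'X)%:P)). Qed.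

Definition shift2 := sval shift2_subproof.

Lemma shift2E p : shift2 p = p \Po ('X + (m.1%:~R * 'X)%:P).
Proof. exact: (svalP shift2_subproof). Qed.

Fact shift_subproof : {f : {rmorphism K3 -> K3} |
  (forall p, f p%:P = (shift2 p)%:P) /\ f 'X = 'X + (m.2%:~R * 'X)%:P%:P}.
Proof.
exists (comp_poly ('X + (m.2%:~R * 'X)%:P%:P) \o map_poly shift2); split=> [p|].
  exact: etrans (congr1 _ (map_polyC _ _)) (comp_polyC _ _).
exact: etrans (congr1 _ (map_polyX _)) (comp_polyX _).
Qed.

Definition shift := sval shift_subproof.

Lemma shift2C p : shift2 p%:P = p%:P.
Proof. by rewrite shift2E comp_polyC. Qed.

Lemma shift2X : shift2 'X = 'X + (m.1%:~R * 'X)%:P.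
Proof. by rewrite shift2E comp_polyX. Qed.

Lemma shift2_MXaddC p c :
  shift2 (p * 'X + c%:P) = shift2 p * ('X + (m.1%:~R * 'X)%:P) + c%:P.
Proof. by rewrite !shift2E comp_poly_MXaddC. Qed.

Lemma shiftC p : shift p%:P = (shift2 p)%:P.
Proof. exact: (svalP shift_subproof).1. Qed.

Lemma shiftX : shift 'X = 'X + (m.2%:~R * 'X)%:P%:P.
Proof. exact: (svalP shift_subproof).2. Qed.

Lemma shift_MXaddC p c : shift (p * 'X + c%:P) =
  shift p * ('X + (m.2%:~R * 'X)%:P%:P) + (shift2 c)%:P.
Proof. by rewrite rmorphD rmorphM shiftC shiftX. Qed.

End Shift.

Arguments shift2 {R} m.
Arguments shift {R} m.

Lemma size_shift2 (R : idomainType) m (p : {poly {poly R}}) :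
  size (shift2 m p) = size p.
Proof. by rewrite shift2E size_comp_poly2 // size_XaddC. Qed.

Lemma solve_affine (C : comNzRingType) (X Y l b s si : C) : s * si = 1 ->
  b * X + s * Y + l = s * (Y - - (si * (b * X + l))).
Proof. by move=> ssi; rewrite opprK mulrDr mulrA ssi; ring. Qed.

Lemma rmorph_mulfV (F : fieldType) (R : nzRingType) (f : {rmorphism F -> R}) k :
  k != 0 -> f k * f k^-1 = 1.
Proof. by move=> k0; rewrite -rmorphM mulfV ?rmorph1. Qed.

(** The condition on [u.[0]] expresses coprimality to [X]. As [u.[0]] need not be a unit, the
    factors [X] are cancelled one at a time instead of using a Bezout relation. *)
Lemma polyX_dvd_coprime (R : idomainType) n (p q u : {poly R}) :
  u.[0] != 0 -> 'X^n * q = p * u -> exists g, p = 'X^n * g.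
Proof.
elim: n p q => [|n IH] p q u0 E; first by exists p; rewrite mul1r.
have /factor_theorem[p' Ep] : root p 0.
  have := congr1 (horner^~ 0) E; rewrite exprS !hornerM hornerX !mul0r => /esym/eqP.
  by rewrite mulf_eq0 (negPf u0) orbF.
rewrite subr0 in Ep.
have /IH[//|g Eg] : 'X^n * q = p' * u.
  apply: (mulfI (monic_neq0 (monicX R))); rewrite mulrA -exprS E Ep; ring.
by exists g; rewrite Ep Eg exprS; ring.
Qed.

Lemma seq_argmin (T : eqType) (t : T -> int) (s : seq T) : s != [::] ->
  exists2 e, e \in s & forall e', e' \in s -> t e <= t e'.
Proof.
case: s => // a s _; elim: s a => [|b s IH] a.
  by exists a => [|e]; rewrite mem_seq1 // => /eqP->.
have [e es emin] := IH b; case: (leP (t a) (t e)) => [ae|/ltW ea].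
  exists a; first exact: mem_head.
  by move=> e'; rewrite inE => /orP[/eqP->//|/emin]; apply: le_trans.
exists e; first by rewrite inE es orbT.
by move=> e'; rewrite inE => /orP[/eqP->//|/emin].
Qed.

Lemma indicator_sum1 (R : pzRingType) (u v w : R) :
  true%:R * u + (false%:R * v + false%:R * w) = u.
Proof. by rewrite mul1r !mul0r !addr0. Qed.

Lemma indicator_sum0 (R : pzRingType) (u v w : R) :
  false%:R * u + (false%:R * v + false%:R * w) = 0.
Proof. by rewrite !mul0r !addr0. Qed.

Lemma is_left_ideal_left_ideal (A : pzRingType) (E : set A) :
  is_left_ideal (left_ideal E).
Proof.
split=> [I [[]]//|u v Eu Ev I HI|p u Eu I HI].
  by have [[_ ID _] _] := HI; apply: ID; [exact: Eu|exact: Ev].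
by have [[_ _ IM] _] := HI; apply: IM; exact: Eu.
Qed.

Section Reduction.
Variables (K : numFieldType) (D : algType K) (M : qdiff_model D).

Local Notation z := (zM M).
Local Notation x := (xM M).
Local Notation y := (yM M).
Local Notation Q := (QM M).
Local Notation ev := (ev M).
Local Notation K2 := {poly {poly K}}.
Local Notation K3 := {poly {poly {poly K}}}.
Local Notation X := ('X%:P : K3).
Local Notation Y := ('X : K3).
Local Notation Z := ('X%:P%:P : K3).
Local Notation e1 := ((1, 0) : int * int).
Local Notation e2 := ((0, 1) : int * int).

Lemma ev_zn (k : int) : ev (k%:~R * 'X)%:P%:P = k%:~R * z.
Proof.
have -> : (k%:~R * 'X)%:P%:P = k%:~R * Z by rewrite !polyCM !rmorph_int.
by rewrite rmorphM rmorph_int ev_z.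
Qed.

Lemma ev_Q g m : ev g * Q m = Q m * ev (shift m g).
Proof.
have E1 (p : {poly K}) : ev p%:P%:P * Q m = Q m * ev p%:P%:P.
  elim/poly_ind: p => [|p k IH]; first by rewrite !polyC0 rmorph0 mul0r mulr0.
  rewrite !polyCD !polyCM; apply: twist_MD => //; rewrite ?ev_C ?ev_z ?zM_Q //.
  by rewrite mulr_algl mulr_algr.
have E2 (p : K2) : ev p%:P * Q m = Q m * ev (shift2 m p)%:P.
  elim/poly_ind: p => [|p k IH]; first by rewrite rmorph0 mul0r !rmorph0 mulr0.
  rewrite shift2_MXaddC polyCD polyCM [in RHS]polyCD [in RHS]polyCM.
  apply: twist_MD => //; rewrite polyCD (rmorphD ev) ev_x xM_Q.
  by rewrite ev_zn.
elim/poly_ind: g => [|g p IH]; first by rewrite !rmorph0 mul0r mulr0.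
rewrite shift_MXaddC; apply: twist_MD => //; rewrite (rmorphD ev) ev_y yM_Q.
by rewrite ev_zn.
Qed.

Variables (N B S : nat).

Local Notation c3 := (lform X Y B.+1 S.+1).
Definition cM : D := ev c3.
Definition boxeM : D := genbox_e ev X Y Z (Q e1) N B S.
Definition boxhM : D := genbox_he ev X Y Z (Q e2) B S.
Definition P0M : D := genP0 ev X Y Z (Q e1) (Q e2) N B S.

(** This is [l(m)]: moving [c] past [q^m] adds [l(m) z]. It is unrelated to [weight], the
    termination measure. *)
Definition weightl (m : int * int) : int := B.+1%:Z * m.1 + S.+1%:Z * m.2.

Definition lZ m : K3 := ((weightl m)%:~R * 'X)%:P%:P.

Lemma lZE m : lZ m = (B.+1%:R * m.1%:~R + S.+1%:R * m.2%:~R) * Z.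
Proof.
by rewrite /lZ /weightl !polyCM !rmorph_int rmorphD !rmorphM /= -!pmulrn.
Qed.

Lemma shift_c3 m : shift m c3 = c3 + lZ m.
Proof.
rewrite /lform rmorphD !rmorphM !rmorph_nat shiftC shift2X shiftX lZE.
rewrite polyCD !polyCM !rmorph_int.
set u := _%:P%:P; move: X Y u _%:~R _%:~R => a b u v w; ring.
Qed.

Lemma cM_Q m : cM * Q m = Q m * ev (c3 + lZ m).
Proof. by rewrite /cM ev_Q shift_c3. Qed.

Lemma cM_P0M : cM * P0M =
  ev (- ((B.+1 + S.+1) * B.+1)%:R) * boxeM
  + ev (S.+1%:R ^+ 2 * X ^+ N) * boxhM.
Proof.
apply: (lform_genP0 (ev_Q^~ e1) (ev_Q^~ e2)).
- by rewrite shiftC shift2X mul1r polyCD.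
- by rewrite shiftX mul0r !polyC0 addr0.
- by rewrite shiftC shift2X mul0r polyC0 addr0.
- by rewrite shiftX mul1r.
Qed.

Lemma koszulM (F : K2) u cl w : Y * (Y - X) = u + cl * w ->
  ev (- (F%:P * u)) * boxeM + ev (F%:P * X ^+ N.+2) * boxhM =
  ev (cl * (F%:P * w)) * boxeM
  - Q e2 * ev (F%:P * rising X Y Z B S S.+1) * boxeM
  + Q e1 * ev ((shift2 e1 F)%:P * ((Y - X - Z) * rising X Y Z B S B.+1)) * boxhM.
Proof.
have sF (p : K2) : shift2 e2 p = p by rewrite shift2E mul0r polyC0 addr0 comp_polyXr.
have s2F (p : K2) : shift e2 p%:P = p%:P := etrans (shiftC e2 p) (congr1 polyC (sF p)).
have s1X : shift e1 X = X + Z by rewrite shiftC shift2X mul1r polyCD.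
have s1Y : shift e1 Y = Y by rewrite shiftX mul0r !polyC0 addr0.
have sZ m : shift m Z = Z by rewrite shiftC shift2C.
have s2Y : shift e2 Y = Y + Z by rewrite shiftX mul1r.
have QC : Q e1 * Q e2 = Q e2 * Q e1 by rewrite -!QMD addrC.
exact: (koszul (ev_Q^~ e1) (ev_Q^~ e2) QC s1X s1Y (sZ _) (s2F _) s2Y (sZ _) N B S
         (shiftC e1 F) (s2F _) (s2F _)).
Qed.

(* The value of [y] at which [c + l(m) z] vanishes. *)
Definition y0 m : K2 :=
  - ((S.+1%:R)^-1%:P%:P * (B.+1%:R * 'X + ((weightl m)%:~R * 'X)%:P)).

Lemma C3_mulfV (k : K) : k != 0 -> k%:P%:P%:P * k^-1%:P%:P%:P = 1 :> K3.
Proof.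
move=> k0; have h := @rmorph_mulfV K K3 (polyC \o polyC \o polyC) k k0.
by apply: (etrans _ h).
Qed.

Lemma c3_root m : c3 + lZ m = (S.+1%:R)%:P%:P%:P * (Y - (y0 m)%:P).
Proof.
have -> : (y0 m)%:P = - ((S.+1%:R)^-1%:P%:P%:P * (B.+1%:R * X + lZ m)).
  by rewrite /y0 polyCN (polyCM _ (_ + _)) polyCD (polyCM _ 'X) (rmorph_nat polyC).
rewrite -solve_affine; first by rewrite !(rmorph_nat polyC).
by rewrite C3_mulfV ?pnatr_eq0.
Qed.

Lemma horner_c3 m : (c3 + lZ m).[y0 m] = 0.
Proof. by rewrite c3_root hornerM hornerXsubC subrr mulr0. Qed.

Lemma coefM_cM P m : coefM M (cM * P) m = (c3 + lZ m) * coefM M P m.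
Proof.
have -> : cM * P = B.+1%:R *: (x * P) + S.+1%:R *: (y * P).
  rewrite /cM /lform (rmorphD ev) !(rmorphM ev) !(rmorph_nat ev) ev_x ev_y.
  by rewrite mulrDl -!mulrA !mulr_natl !scaler_nat.
rewrite coefMD !coefMZ coefMx coefMy !(rmorph_nat polyC) lZE /lform.
move: (coefM _ _ _) (X) (Y) (Z) => c X Y Z; ring.
Qed.

Lemma coefM_cM_root P m : (coefM M (cM * P) m).[y0 m] = 0.
Proof. by rewrite coefM_cM hornerM horner_c3 mul0r. Qed.

(** On coefficients [c] acts as multiplication by [c3 + lZ m], which has degree one in [y] and so is
    a nonzero element of a domain. *)
Lemma cM_lreg P : cM * P = 0 -> P = 0.
Proof.
move=> cP0; apply: (coefM_eq0 (M := M)) => m; apply/eqP.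
have : (c3 + lZ m) * coefM M P m == 0.
  by rewrite -coefM_cM cP0 coefM0.
rewrite mulf_eq0 c3_root mulf_eq0 polyXsubC_eq0 orbF !polyC_eq0 pnatr_eq0.
by [].
Qed.

(** Division by [c + l(m) z], whose leading coefficient in [y] is the invertible constant [S.+1];
    the remainder lies in [K[z, x]]. *)
Lemma reduce_cM m g : exists U, Q m * ev g = cM * U + Q m * ev (g.[y0 m])%:P.
Proof.
have /factor_theorem[h gh] : root (g - (g.[y0 m])%:P) (y0 m).
  by rewrite /root hornerD hornerN hornerC subrr.
exists (Q m * ev ((S.+1%:R)^-1%:P%:P%:P * h)).
rewrite mulrA cM_Q -mulrA -mulrDr -(rmorphM ev) -(rmorphD ev); congr (_ * ev _).
rewrite c3_root mulrACA C3_mulfV ?pnatr_eq0 // mul1r mulrC -gh.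
by rewrite subrK.
Qed.

(** * Finite sums of entries and termination of the reduction *)

Local Notation entry := ((int * int) * (K2 * K2))%type.

Definition term (e : entry) : D :=
  Q e.1 * (ev e.2.1%:P * boxeM + ev e.2.2%:P * boxhM).

(* The exponents [size al + n] and [size be + 2] of [weight] would agree if
   [al = - f y_0 (y_0 - x)] and [be = x^n f]; base 3 makes the weight decrease
   when one entry is replaced by two entries of lower degree. *)
Definition wpoly (j : nat) (p : K2) : nat :=
  (if p == 0%R then 0 else 3 ^ (size p + j))%N.

(** The successor counts the entry itself, so that merging two entries or discarding one lowers the
    total. *)
Definition weight (e : entry) : nat :=
  (wpoly N.+2 e.2.1 + wpoly 2 e.2.2).+1.

Lemma wpolyD j p r : (wpoly j (p + r) <= wpoly j p + wpoly j r)%N.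
Proof.
rewrite /wpoly; have [->|p0] := eqVneq p 0; first by rewrite add0r.
have [->|r0] := eqVneq r 0; first by rewrite addr0 (negPf p0) addn0.
case: eqP => // _; have := size_polyD p r; rewrite leq_max => /orP[] le_pr.
  by apply: leq_trans (leq_addr _ _); rewrite leq_pexp2l // leq_add2r.
by apply: leq_trans (leq_addl _ _); rewrite leq_pexp2l // leq_add2r.
Qed.

Lemma wpoly_le j (p : K2) k : (size p <= k)%N -> (wpoly j p <= 3 ^ (k + j))%N.
Proof. by rewrite /wpoly; case: eqP => // _ ?; rewrite leq_pexp2l // leq_add2r. Qed.

Lemma coefM_term e : exists g1 g2, forall m, coefM M (term e) m =
  (m == e.1)%:R * (e.2.1%:P * X ^+ N.+2 + e.2.2%:P * (Y * (Y - X)))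
  + ((m == e.1 + e1)%:R * g1 + (m == e.1 + e2)%:R * g2).
Proof.
have [g1 [g2 E]] := boxes_expand X Y Z (ev_Q^~ e1) (ev_Q^~ e2) N B S
  e.2.1%:P e.2.2%:P.
exists g1, g2 => m.
have -> : term e = Q e.1 *
    ev (e.2.1%:P * X ^+ N.+2 + e.2.2%:P * (Y * (Y - X)))
    + (Q (e.1 + e1) * ev g1 + Q (e.1 + e2) * ev g2).
  by rewrite !QMD -!mulrA -!mulrDr -E.
by rewrite !coefMD !coefM_Qev.
Qed.

Definition idealM P := exists U V W, P = U * P0M + V * boxeM + W * boxhM.

Lemma idealM_add P P' : idealM P -> idealM P' -> idealM (P + P').
Proof.
move=> [U [V [W ->]]] [U' [V' [W' ->]]].
exists (U + U'), (V + V'), (W + W').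
by rewrite !mulrDl addrACA [X in X + _ = _]addrACA.
Qed.

Lemma idealM_boxes V W : idealM (V * boxeM + W * boxhM).
Proof. by exists 0, V, W; rewrite mul0r add0r. Qed.

(** At [y0 m] the form [c] takes the value [- l(m) z], so every factor becomes a multiple of [z] and
    the product does not raise the degree in [x]. *)
Lemma rising_y0 m k : exists c : {poly K}, (rising X Y Z B S k).[y0 m] = c%:P.
Proof.
elim: k => [|k [c Ec]].
  by exists 1; rewrite /rising big_geq // hornerC.
exists (c * (k.+1%:R * 'X - (weightl m)%:~R * 'X)).
rewrite risingS hornerM Ec polyCM; congr (_ * _).
have -> : c3 + k.+1%:R * Z = (c3 + lZ m) + (k.+1%:R * Z - lZ m).
  by rewrite [RHS]addrC -[RHS]addrA [- _ + _]addrC addrK addrC.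
rewrite hornerD horner_c3 add0r.
have -> : k.+1%:R * Z - lZ m = (k.+1%:R * 'X - (weightl m)%:~R * 'X)%:P%:P.
  by rewrite /lZ !polyCD !polyCN !polyCM !(rmorph_nat polyC).
by rewrite hornerC.
Qed.

Lemma size_y0B m : (size (y0 m - 'X - 'X%:P)%R <= 2)%N.
Proof.
have -> : y0 m - 'X - 'X%:P =
    (- (S.+1%:R^-1%:P * B.+1%:R) - 1)%:P * 'X +
    (- (S.+1%:R^-1%:P * ((weightl m)%:~R * 'X)) - 'X)%:P.
  rewrite /y0 !polyCD !polyCN !(polyCM (S.+1%:R^-1%:P)) (rmorph_nat polyC) polyC1.
  move: (_%:P%:P) (_ * 'X)%:P ('X%:P) => a b c; ring.
rewrite size_MXaddC; case: ifP => // _.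
by rewrite ltnS size_polyC leq_b1.
Qed.

Lemma y0E m : S.+1%:R * y0 m = - (B.+1%:R * 'X + ((weightl m)%:~R * 'X)%:P).
Proof.
have S0 : S.+1%:R != 0 :> K by rewrite pnatr_eq0.
have h := @rmorph_mulfV K K2 (polyC \o polyC) S.+1%:R S0.
rewrite rmorph_nat in h.
rewrite /y0 mulrN mulrA; congr (- _); rewrite -[RHS]mul1r; congr (_ * _).
exact: h.
Qed.

(** If [l(m) = 0], then [s y_0 = - beta x] and [s (y_0 - x) = - (beta + s) x]. *)
Lemma y0_quad m : weightl m = 0 ->
  S.+1%:R ^+ 2 * (y0 m * (y0 m - 'X)) = ((B.+1 + S.+1) * B.+1)%:R * 'X ^+ 2.
Proof.
move=> l0; have := y0E m; rewrite l0 mul0r polyC0 addr0 => h.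
have -> : S.+1%:R ^+ 2 * (y0 m * (y0 m - 'X)) =
    S.+1%:R * y0 m * (S.+1%:R * y0 m - S.+1%:R * 'X) by ring.
rewrite h; ring.
Qed.

(** At [x = 0] the product is the square of [- l(m) z / s], nonzero in characteristic zero. *)
Lemma y0_quad0 m : weightl m != 0 -> (y0 m * (y0 m - 'X)).[0] != 0.
Proof.
move=> l0.
have h : (S.+1%:R * y0 m).[0] =
    (- (B.+1%:R * 'X + ((weightl m)%:~R * 'X)%:P)).[0].
  by rewrite y0E.
rewrite (hornerM (y0 m)) (hornerD (y0 m)) (hornerN 'X) hornerX subr0 mulf_eq0 orbb.
apply/eqP => y00; move/eqP: h; apply/negP.
rewrite hornerM y00 mulr0 hornerN hornerD hornerM hornerX mulr0 add0r hornerC.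
rewrite eq_sym oppr_eq0 mulf_eq0 -(rmorph_int polyC) polyC_eq0 intr_eq0.
by rewrite (negPf l0) polyX_eq0.
Qed.

(** By [y0_quad] the relation puts [al] and [be] in the proportion in which the boxes occur in
    [c P0]. Thus [- a beta] times the term is [q^m al c P0], and [c] commutes with [q^m] because
    [l(m) = 0]. *)
Lemma term_split0 e : weightl e.1 = 0 ->
    e.2.1 * 'X ^+ N.+2 + e.2.2 * (y0 e.1 * (y0 e.1 - 'X)) = 0 ->
  exists2 V, idealM V & term e = cM * V.
Proof.
case: e => m [al be] /= l0 E.
pose k : nat := ((B.+1 + S.+1) * B.+1)%N.
have kbe : k%:R * be = - (S.+1%:R ^+ 2 * al * 'X ^+ N).
  have X2 : ('X ^+ 2 : K2) != 0 by rewrite expf_neq0 // polyX_eq0.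
  apply: (mulfI X2); have := congr1 ( *%R (S.+1%:R ^+ 2)) E.
  rewrite mulr0 mulrDr [X in _ + X]mulrCA y0_quad // => /eqP.
  rewrite addrC addr_eq0 => /eqP h.
  have -> : 'X ^+ 2 * (k%:R * be) = be * (k%:R * 'X ^+ 2) by ring.
  rewrite h (exprS 'X N.+1) (exprS 'X N). ring.
have kV : k%:R * term (m, (al, be)) = - (cM * (Q m * (ev al%:P * P0M))).
  have -> : cM * (Q m * (ev al%:P * P0M)) = Q m * (ev al%:P * (cM * P0M)).
    have lZ0 : lZ m = 0 by rewrite /lZ l0 mul0r !polyC0.
    rewrite mulrA cM_Q lZ0 addr0 -mulrA; congr (_ * _).
    rewrite !mulrA; congr (_ * _).
    by rewrite /cM -!(rmorphM ev) mulrC.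
  rewrite cM_P0M -mulrN mulr_natl -mulrnAr; congr (_ * _).
  move: boxeM boxhM => boxe boxh.
  rewrite -mulr_natl /= !mulrDr !mulrA -(rmorph_nat ev k) -!(rmorphM ev).
  rewrite opprD -!mulNr -!(rmorphN ev); congr (ev _ * _ + ev _ * _).
    by rewrite mulrN opprK mulrC.
  rewrite -(rmorph_nat polyC k) -polyCM kbe polyCN !polyCM !(rmorphXn polyC).
  by rewrite (rmorph_nat polyC) mulrAC mulrC.
have k0 : k%:R != 0 :> K by rewrite pnatr_eq0.
exists (- (k%:R^-1 *: (Q m * (ev al%:P * P0M)))).
  exists (- (k%:R^-1 *: (Q m * ev al%:P))), 0, 0.
  by rewrite !mul0r !addr0 mulNr -scalerAl mulrA.
apply: (scalerI k0); rewrite mulrN scalerN -scalerAr scalerA mulfV // scale1r.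
by rewrite -kV scaler_nat mulr_natl.
Qed.

Lemma term_split1 e : weightl e.1 != 0 ->
    e.2.1 * 'X ^+ N.+2 + e.2.2 * (y0 e.1 * (y0 e.1 - 'X)) = 0 ->
  exists V, idealM V /\ exists s : seq entry, term e = cM * V + \sum_(i <- s) term i /\
    (\sum_(i <- s) weight i < weight e)%N.
Proof.
case: e => m [al be] /= l0 E; pose u : K2 := y0 m * (y0 m - 'X).
have [F EF] : exists F, be = 'X ^+ N.+2 * F.
  apply: (@polyX_dvd_coprime _ N.+2 be (- al) u); first exact: y0_quad0.
  have := E; rewrite -/u => /eqP; rewrite addrC addr_eq0 => /eqP->.
  by rewrite mulrN mulrC.
have Eal : al = - (F * u).
  have Xn : ('X ^+ N.+2 : K2) != 0 by rewrite expf_neq0 // polyX_eq0.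
  apply: (mulfI Xn); have := E; rewrite -/u EF => /eqP; rewrite addr_eq0 => /eqP h.
  rewrite mulrC h {h}; clearbody u; move: ('X ^+ _) u => a b; ring.
(* If [F = 0], the entry vanishes and is replaced by nothing. *)
have [F0|F0] := eqVneq F 0.
  exists 0; split; first by exists 0, 0, 0; rewrite !mul0r !addr0.
  exists [::]; rewrite !big_nil mulr0 addr0; split=> //.
  by rewrite /term Eal EF F0 mul0r oppr0 mulr0 /= polyC0 rmorph0 !mul0r addr0 mulr0.
have [cl Ecl] : exists cl : K3, cl = c3 + lZ m by eexists.
(* The quotient of [Y (Y - X) - u] by [c + l(m) z]: the difference factors as
   [(Y - y_0) (Y + y_0 - X)]. *)
pose w : K3 := (S.+1%:R^-1)%:P%:P%:P * (Y + (y0 m)%:P - X).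
have YX : Y * (Y - X) = u%:P + cl * w.
  rewrite Ecl /w c3_root mulrACA C3_mulfV ?pnatr_eq0 // mul1r /u.
  move: (y0 m) => v; rewrite polyCM polyCD polyCN.
  move: (Y) (X) (v%:P) => a b c; ring.
clearbody u w.
have := koszulM F YX.
set g2 := _ * rising _ _ _ _ _ S.+1; set g1 := _ * (_ * rising _ _ _ _ _ B.+1) => K0.
(* The coefficients left by the syzygy still involve [y] and are reduced again. *)
have [U2 EU2] := reduce_cM (m + e2) (- g2).
have [U1 EU1] := reduce_cM (m + e1) g1.
exists ((Q m * ev (F%:P * w) + U2) * boxeM + U1 * boxhM).
split; first exact: idealM_boxes.
exists [:: (m + e2, ((- g2).[y0 (m + e2)], 0)); (m + e1, (0, g1.[y0 (m + e1)]))].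
split.
  have -> : term (m, (al, be)) = Q m * (ev (- (F%:P * u%:P)) * boxeM
      + ev (F%:P * X ^+ N.+2) * boxhM).
    by rewrite /term /= Eal EF polyCN (polyCM F) (polyCM ('X ^+ _))
      (rmorphXn polyC) [X ^+ _ * _]mulrC.
  have E1 : Q m * (ev (cl * (F%:P * w)) * boxeM) =
      cM * (Q m * ev (F%:P * w)) * boxeM.
    by rewrite (rmorphM ev cl) !mulrA cM_Q Ecl.
  have E2 : Q m * (Q e2 * ev g2 * boxeM) =
      - ((cM * U2 + Q (m + e2) * ev ((- g2).[y0 (m + e2)])%:P) * boxeM).
    by rewrite -EU2 QMD (rmorphN ev) mulrN mulNr opprK !mulrA.
  have E3 : Q m * (Q e1 * ev g1 * boxhM) =
      (cM * U1 + Q (m + e1) * ev (g1.[y0 (m + e1)])%:P) * boxhM.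
    by rewrite -EU1 QMD !mulrA.
  rewrite !big_cons big_nil /term /=.
  move: boxeM boxhM K0 E1 E2 E3 => boxe boxh -> E1 E2 E3.
  rewrite mulrDr mulrBr E1 E2 E3 opprK.
  rewrite polyC0 rmorph0 !mul0r add0r !addr0.
  rewrite (mulrDr cM) !mulrDl (mulrDr cM) !mulrA -!addrA; do 2!congr (_ + _).
  by rewrite addrCA.
rewrite !big_cons big_nil addn0 /weight /= {2 3}/wpoly eqxx add0n addn0.
(* At [y_0] the rising product is constant in [x], so the size is at most that of [F]; in [s1] the
   factor [Y - X - Z] adds at most one. *)
have s2 : (size ((- g2).[y0 (m + e2)])%R <= size F + 0)%N.
  have [c Ec] := rising_y0 (m + e2) S.+1.
  rewrite /g2 hornerN size_polyN hornerM hornerC Ec mulrC mul_polyC addn0.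
  exact: size_scale_leq.
have s1 : (size (g1.[y0 (m + e1)])%R <= size F + 1)%N.
  have [c Ec] := rising_y0 (m + e1) B.+1.
  rewrite /g1 hornerM hornerC hornerM Ec -(size_shift2 e1 F).
  have -> : (Y - X - Z).[y0 (m + e1)] = y0 (m + e1) - 'X - 'X%:P.
    by rewrite !hornerD !hornerN hornerX !hornerC.
  apply: leq_trans (size_polyMleq _ _) _; rewrite -subn1 leq_subLR addnCA leq_add2l.
  rewrite mulrC mul_polyC; apply: leq_trans (size_scale_leq _ _) _.
  exact: size_y0B.
have := wpoly_le N.+2 s2; have := wpoly_le 2 s1.
have -> : wpoly 2 be = (3 ^ (N.+2 + size F + 2))%N.
  by rewrite /wpoly EF mulrC size_mulXn // mulf_eq0 (negPf F0) expf_eq0 polyX_eq0.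
have T0 : (0 < 3 ^ size F)%N by rewrite expn_gt0.
have N0 : (0 < 3 ^ N)%N by rewrite expn_gt0.
rewrite -[N.+2]addn2 !expnD expn0 muln1 !expnS expn0.
(* With [t = 3^(size F)] and [r = 3^N], the new entries weigh at most [9 t r + 1] and [27 t + 1],
   the old one at least [81 t r + 1]. *)
move: (3 ^ size F)%N (3 ^ N)%N T0 N0 => t r t0 r0.
have tr := leq_pmulr t r0.
move: (wpoly _ _) (wpoly _ _) (wpoly _ _) => v1 v2 v3; clear - tr t0; nia.
Qed.

(** Induction on the total weight: each step merges two entries, or splits off a left multiple [c V]
    with [V] in the ideal and continues with [P - V]. *)
Lemma colon_sub_ind s P : cM * P = \sum_(e <- s) term e -> idealM P.
Proof.
have [k] := ubnP (\sum_(e <- s) weight e); elim: k s P => // k IH s P ltk EP.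
have [s0|/(seq_argmin (fun e : entry => e.1.1 + e.1.2))[e es emin]] := eqVneq s [::].
  move: EP; rewrite s0 big_nil => /cM_lreg->.
  by exists 0, 0, 0; rewrite !mul0r !addr0.
pose s' := rem e s.
have Es (F : entry -> D) : \sum_(i <- s) F i = F e + \sum_(i <- s') F i.
  by rewrite (perm_big _ (perm_to_rem es)) big_cons.
have Ew : (\sum_(i <- s) weight i = weight e + \sum_(i <- s') weight i)%N.
  by rewrite (perm_big _ (perm_to_rem es)) big_cons.
(* An entry sharing the exponent of [e] is merged into it; otherwise [e] is alone at its
   exponent. *)
have [/hasP[e' e's' /eqP ee']|/hasPn noe] := boolP (has (fun i => i.1 == e.1) s').
  apply: (IH ((e.1, (e.2.1 + e'.2.1, e.2.2 + e'.2.2)) :: rem e' s')).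
    move: ltk; rewrite Ew (perm_big _ (perm_to_rem e's')) !big_cons /weight /=.
    have := wpolyD N.+2 e.2.1 e'.2.1; have := wpolyD 2 e.2.2 e'.2.2.
    move: (wpoly _ _) (wpoly _ _) (wpoly _ _) (wpoly _ _) (wpoly _ _) (wpoly _ _)
      (\sum_(j <- _) _)%N; clear; lia.
  rewrite EP Es (perm_big _ (perm_to_rem e's')) !big_cons addrA; congr (_ + _).
  rewrite /term /= ee' -mulrDr; congr (_ * _).
  by rewrite !rmorphD /= !mulrDl addrACA.
(* The other entries do not contribute at [e.1]: their exponents differ from it, and adding [e1] or
   [e2] to them exceeds the minimal total degree. *)
have eq0 : e.2.1 * 'X ^+ N.+2 + e.2.2 * (y0 e.1 * (y0 e.1 - 'X)) = 0.
  have := coefM_cM_root P e.1; rewrite EP Es coefMD coefM_sum.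
  have addL (d : int * int) i : e.1.1 + e.1.2 <= i.1 + i.2 -> 0 < d.1 + d.2 ->
      (e.1 == i + d) = false.
    move=> ei d0; apply/negP => /eqP ed; move: ei; rewrite ed /=; lia.
  rewrite big_seq big1 ?addr0 => [|i is'].
    have [g1 [g2 ->]] := coefM_term e.
    rewrite eqxx !addL // indicator_sum1 hornerD (hornerCM e.2.1) (hornerCM e.2.2).
    rewrite horner_exp hornerC.
    by rewrite (hornerM Y) (hornerD Y) (hornerN X) hornerX hornerC.
  have [g1 [g2 ->]] := coefM_term i.
  rewrite eq_sym (negPf (noe i is')) !addL ?indicator_sum0 //.
    by apply: emin; apply: mem_rem is'.
  by apply: emin; apply: mem_rem is'.
have tail V : idealM V -> forall t, term e = cM * V + \sum_(i <- t) term i ->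
    (\sum_(i <- t) weight i < weight e)%N -> idealM P.
  move=> VJ t Et wt; rewrite -(subrK V P); apply: idealM_add VJ.
  apply: (IH (t ++ s')).
    have wk : (weight e + \sum_(i <- s') weight i <= k)%N by rewrite -ltnS -Ew.
    by apply: leq_trans wk; rewrite big_cat -addSn leq_add2r.
  by rewrite mulrBr EP Es Et big_cat /= addrAC [cM * V + _]addrC addrK.
have [l0|l0] := eqVneq (weightl e.1) 0.
  have [V VJ EV] := term_split0 l0 eq0.
  by apply: (tail V VJ [::]); rewrite big_nil ?addr0.
have [V [VJ [t [Et wt]]]] := term_split1 l0 eq0.
exact: tail VJ t Et wt.
Qed.

Lemma reduced_span P : exists (s : seq ((int * int) * K2)) A',
  P = cM * A' + \sum_(e <- s) Q e.1 * ev e.2%:P.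
Proof.
have [s ->] := span_Qev M P; elim: s => [|[m g] s [t [A' E]]].
  by exists [::], 0; rewrite !big_nil mulr0 addr0.
have [U EU] := reduce_cM m g.
exists ((m, g.[y0 m]) :: t), (U + A').
by rewrite !big_cons /= E EU mulrDr addrACA.
Qed.

(** The multiples [c U] and [c U'] inside the coefficients of the boxes are removed by subtracting
    [U * boxeM + U' * boxhM] from [P]. *)
Lemma colon_sub P A A' : cM * P = A * boxeM + A' * boxhM -> idealM P.
Proof.
have [s [U ->]] := reduced_span A; have [s' [U' ->]] := reduced_span A'.
move=> EP; rewrite -(subrK (U * boxeM + U' * boxhM) P).
apply: idealM_add (idealM_boxes _ _).
apply: (@colon_sub_ind ([seq (e.1, (e.2, 0)) | e <- s]
  ++ [seq (e.1, (0, e.2)) | e <- s'])).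
have T1 : \sum_(e <- s) term (e.1, (e.2, 0)) =
    (\sum_(e <- s) Q e.1 * ev e.2%:P) * boxeM.
  rewrite mulr_suml; apply: eq_bigr => e _.
  by rewrite /term /= polyC0 rmorph0 mul0r addr0 mulrA.
have T2 : \sum_(e <- s') term (e.1, (0, e.2)) =
    (\sum_(e <- s') Q e.1 * ev e.2%:P) * boxhM.
  rewrite mulr_suml; apply: eq_bigr => e _.
  by rewrite /term /= polyC0 rmorph0 mul0r add0r mulrA.
rewrite big_cat !big_map T1 T2 mulrBr EP.
move: boxeM boxhM => boxe boxh.
rewrite !mulrDl mulrDr !mulrA addrACA [X in X - _]addrC addrK.
by [].
Qed.

Lemma colonM : left_colon (left_ideal [set boxeM; boxhM]) cM =
  left_ideal [set P0M; boxeM; boxhM].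
Proof.
set G := left_ideal [set boxeM; boxhM].
have [G0 GD GM] : is_left_ideal G by exact: is_left_ideal_left_ideal.
have Ge : G boxeM by apply: sub_gen_smallest; left.
have Gh : G boxhM by apply: sub_gen_smallest; right.
have [J0 JD JM] := is_left_ideal_left_ideal [set P0M; boxeM; boxhM].
have Jgen u : [set P0M; boxeM; boxhM] u -> left_ideal [set P0M; boxeM; boxhM] u.
  exact: sub_gen_smallest.
have GE u : G u -> exists V W, u = V * boxeM + W * boxhM.
  apply: (@smallest_sub _ _ _ [set u | exists V W, u = V * boxeM + W * boxhM]).
    split=> [|u1 u2 [V [W ->]] [V' [W' ->]]|p u1 [V [W ->]]].
    - by exists 0, 0; rewrite !mul0r addr0.
    - by exists (V + V'), (W + W'); rewrite !mulrDl addrACA.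
    - by exists (p * V), (p * W); rewrite mulrDr !mulrA.
  move=> v [->|->]; first by exists 1, 0; rewrite mul1r mul0r addr0.
  by exists 0, 1; rewrite mul1r mul0r add0r.
(* Both sides are generated left ideals, so each inclusion is checked on generators; on the left
   these are all [P] with [c P] in [G]. *)
apply/seteqP; split; apply: smallest_sub; try exact: is_left_ideal_left_ideal.
  move=> P /= /GE[V [W /colon_sub[U [V' [W' ->]]]]].
  apply: (JD); first apply: (JD); apply: (JM); apply: (Jgen).
  - by left; left.
  - by left; right.
  - by right.
move=> u [[->|->]|->]; apply: sub_gen_smallest => /=.
- by rewrite cM_P0M; apply: GD; apply: GM.
- exact: GM.
- exact: GM.
Qed.

(** * The boxes and [P0] in terms of the generators *)

Local Notation c := (B.+1%:R * x + S.+1%:R * y).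

Lemma cME : cM = c.
Proof. by rewrite /cM /lform (rmorphD ev) !(rmorphM ev) !(rmorph_nat ev) ev_x ev_y. Qed.

Lemma ev_rising k : ev (rising X Y Z B S k) = \prod_(1 <= nu < k.+1) (c + nu%:R * z).
Proof.
rewrite /rising (rmorph_prod ev); apply: eq_bigr => nu _.
by rewrite (rmorphD ev) (rmorphM ev) rmorph_nat ev_z -cME.
Qed.

Lemma boxeME : boxeM =
  x ^+ N.+2 - Q e1 * (y - x) * \prod_(1 <= nu < B.+2) (c + nu%:R * z).
Proof.
rewrite /boxeM /genbox_e (rmorphXn ev) ev_x (rmorphM ev) ev_rising.
by rewrite (rmorphB ev) ev_x ev_y mulrA.
Qed.

Lemma boxhME : boxhM =
  y * (y - x) - Q e2 * \prod_(1 <= nu < S.+2) (c + nu%:R * z).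
Proof.
by rewrite /boxhM /genbox_he (rmorphM ev) ev_rising (rmorphB ev) ev_x ev_y.
Qed.

Lemma P0ME : P0M =
  - (B.+1 + S.+1)%:R * x ^+ N.+1 + S.+1%:R * x ^+ N * y
  + ((B.+1 + S.+1) * B.+1)%:R * Q e1 * (y - x) * \prod_(1 <= nu < B.+1) (c + nu%:R * z)
  - S.+1%:R ^+ 2 * Q e2 * x ^+ N * \prod_(1 <= nu < S.+1) (c + nu%:R * z).
Proof.
rewrite /P0M /genP0 (rmorphD ev) !(rmorphM ev) (rmorphN ev) !(rmorphXn ev).
rewrite !(rmorph_nat ev) ev_x ev_y !ev_rising (rmorphB ev) ev_x ev_y !mulrA.
have nQ (k : nat) m : k%:R * Q m = Q m * k%:R by rewrite mulr_natl mulr_natr.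
by rewrite nQ -natrX nQ natrX expr2 !mulrA.
Qed.

Section IntParameters.
Variables a b : int.
Hypotheses (bE : b = - B.+1%:Z) (abE : a + b = S.+1%:Z).

Local Notation cz := ((- b)%:~R * x + (a + b)%:~R * y).
(** Spelled out with the case distinction of [ctop_prod], so that the formulas below agree with the
    given definitions by conversion. *)
Local Notation prodz m :=
  (if m is Posz k then \prod_(1 <= nu < k.+1) (cz + nu%:R * z) else 1).

Lemma cM_int : cM = cz.
Proof. by rewrite cME bE opprK -bE abE. Qed.

Lemma boxeM_int : boxeM = x ^+ N.+2 - Q e1 * (y - x) * prodz (- b).
Proof. by rewrite boxeME -cME cM_int; have -> : - b = B.+1 by rewrite bE opprK. Qed.

Lemma boxhM_int : boxhM = y * (y - x) - Q e2 * prodz (a + b).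
Proof. by rewrite boxhME -cME cM_int abE. Qed.

Lemma P0M_int : P0M =
  - a%:~R * x ^+ (N.+2 - 1) + (a + b)%:~R * x ^+ (N.+2 - 2) * y
  - (a * b)%:~R * Q e1 * (y - x) * prodz (- b - 1)
  - (a + b)%:~R ^+ 2 * Q e2 * x ^+ (N.+2 - 2) * prodz (a + b - 1).
Proof.
rewrite P0ME -cME cM_int.
have -> : - b - 1 = B by rewrite bE; lia.
have -> : a + b - 1 = S by rewrite abE; lia.
rewrite abE; have -> : a * b = - ((B.+1 + S.+1) * B.+1)%N%:Z by nia.
have -> : a = (B.+1 + S.+1)%N by lia.
by rewrite subn1 subn2 rmorphN !mulNr opprK.
Qed.

End IntParameters.

End Reduction.

(** * The presented algebra is a model *)

Lemma comm_inverse (A : nzRingType) (a u v : A) :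
  u * v = 1 -> v * u = 1 -> GRing.comm a u -> GRing.comm a v.
Proof.
move=> uv vu au; rewrite /GRing.comm -[a * v]mul1r -vu -!mulrA (mulrA u).
by rewrite -au -mulrA uv mulr1.
Qed.

Section IntPower.
Variables (A : nzRingType) (u v : A).
Hypotheses (uv : u * v = 1) (vu : v * u = 1).

Definition intpow (k : int) : A :=
  match k with Posz n => u ^+ n | Negz n => v ^+ n.+1 end.

Lemma intpowS k : intpow (k + 1) = u * intpow k.
Proof.
case: k => [n|[|n]]; first by rewrite addrC -intS /= exprS.
  by rewrite /= expr1 uv.
have -> : Negz n.+1 + 1 = Negz n by lia.
by rewrite /= [in RHS]exprS mulrA uv mul1r.
Qed.

Lemma intpowP k : intpow (k - 1) = v * intpow k.
Proof. by rewrite -{2}[k](subrK 1) intpowS mulrA vu mul1r. Qed.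

Lemma intpow_ind (S : int -> Prop) : S 0 ->
  (forall k, S k -> S (k + 1)) -> (forall k, S k -> S (k - 1)) -> forall k, S k.
Proof.
move=> S0 SS SP; elim/int_ind => // n IH.
  by have := SS _ IH; rewrite addrC -intS.
have -> : - n.+1%:Z = - n%:Z - 1 by lia.
exact: SP.
Qed.

Lemma intpowD k l : intpow (k + l) = intpow k * intpow l.
Proof.
elim/intpow_ind: k => [|k IH|k IH]; first by rewrite add0r mul1r.
  by rewrite addrAC !intpowS IH mulrA.
by rewrite addrAC !intpowP IH mulrA.
Qed.

Lemma comm_intpow t k : GRing.comm t u -> GRing.comm t (intpow k).
Proof.
move=> tu; have tv := comm_inverse uv vu tu.
by case: k => n /=; apply: commrX.
Qed.

(** Passing [u] adds [c] and passing its inverse [v] subtracts it; as [c] commutes with [u], the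
    contributions accumulate to [c *~ k]. *)
Lemma twist_intpow t c k : GRing.comm c u -> t * u = u * (t + c) ->
  t * intpow k = intpow k * (t + c *~ k).
Proof.
move=> cu tu; have tv : t * v = v * (t - c).
  have cv := comm_inverse uv vu cu.
  rewrite -[LHS]mul1r -vu -mulrA (mulrA u).
  have -> : u * t = t * u - u * c by rewrite tu mulrDr addrK.
  by rewrite mulrBl -!mulrA uv mulr1 cv mulrA uv mul1r.
elim/intpow_ind: k => [|k IH|k IH]; first by rewrite mulr0z addr0 mulr1 mul1r.
  rewrite intpowS mulrA tu -!mulrA mulrDl IH (comm_intpow k cu) -mulrDr.
  by rewrite mulrzDr mulr1z addrA.
rewrite intpowP mulrA tv -!mulrA mulrBl IH (comm_intpow k cu) -mulrBr.
by rewrite mulrzBr mulr1z addrA.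
Qed.

End IntPower.

Definition unitv (i : 'I_2) : int * int := if i == ord0 then (1, 0) else (0, 1).
Definition compv (i : 'I_2) (m : int * int) : int := if i == ord0 then m.1 else m.2.
Definition varp (R : nzRingType) (i : 'I_2) : {poly {poly {poly R}}} :=
  if i == ord0 then 'X%:P else 'X.

Section Build.
Variables (K : numFieldType) (A : algType K).
Variables (z : A) (q qi d : 'I_2 -> A).
Variable coef : A -> int * int -> {poly {poly {poly K}}}.

Hypotheses (zq : forall i, GRing.comm z (q i)) (zd : forall i, GRing.comm z (d i))
  (qq : forall i j, GRing.comm (q i) (q j)) (qqi : forall i, q i * qi i = 1)
  (qiq : forall i, qi i * q i = 1)
  (dq : forall i j, d i * q j = q j * d i + (i == j)%:R * (z * q j))
  (dd : forall i j, GRing.comm (d i) (d j)).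
Hypothesis A_ind : forall S : A -> Prop,
  S 1 -> (forall P P', S P -> S P' -> S (P + P')) ->
  (forall (k : K) P, S P -> S (k *: P)) ->
  (forall P, S P -> S (z * P)) -> (forall i P, S P -> S (d i * P)) ->
  (forall i P, S P -> S (q i * P)) -> (forall i P, S P -> S (qi i * P)) ->
  forall P, S P.
Hypotheses (coefD : forall P P' m, coef (P + P') m = coef P m + coef P' m)
  (coefZ : forall k P m, coef (k *: P) m = k%:P%:P%:P * coef P m)
  (coef1 : forall m, coef 1 m = (m == 0)%:R)
  (coefz : forall P m, coef (z * P) m = 'X%:P%:P * coef P m)
  (coefd : forall i P m,
    coef (d i * P) m = (varp K i + (compv i m)%:~R * 'X%:P%:P) * coef P m)
  (coefq : forall i P m, coef (q i * P) m = coef P (m - unitv i))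
  (coefqi : forall i P m, coef (qi i * P) m = coef P (m + unitv i)).

Definition qpow i k := intpow (q i) (qi i) k.
Definition qmon (m : int * int) : A := qpow ord0 m.1 * qpow ord_max m.2.

Lemma qpow_comm i j k l : qpow i k * qpow j l = qpow j l * qpow i k.
Proof.
apply: comm_intpow; rewrite ?qqi ?qiq //; apply/commr_sym.
by apply: comm_intpow; rewrite ?qqi ?qiq //; apply: qq.
Qed.

Lemma qmonD m k : qmon (m + k) = qmon m * qmon k.
Proof.
rewrite /qmon /= /qpow !intpowD ?qqi ?qiq // -!/(qpow _ _) -!mulrA.
by congr (_ * _); rewrite !mulrA qpow_comm.
Qed.

Lemma z_qmon m : z * qmon m = qmon m * z.
Proof.
by apply: commrM; apply: comm_intpow; rewrite ?qqi ?qiq //; apply: zq.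
Qed.

Lemma d_qpow i j k : d i * qpow j k = qpow j k * (d i + (z *+ (i == j)) *~ k).
Proof.
apply: twist_intpow; rewrite ?qqi ?qiq //.
  by apply/commr_sym/commrMn/commr_sym/zq.
by rewrite dq mulrDr mulr_natl mulrnAr zq.
Qed.

Lemma d_qmon i m : d i * qmon m = qmon m * (d i + z *~ compv i m).
Proof.
have zQ k j l : GRing.comm (z *~ k) (qpow j l).
  by apply/commr_sym/commrMz/commr_sym; apply: comm_intpow; rewrite ?qqi ?qiq.
rewrite /qmon mulrA d_qpow -mulrA mulrDl d_qpow /compv.
case: (unliftP ord0 i) => [j ->|->] /=.
  have -> : (lift ord0 j == ord_max) = true by rewrite (ord1 j).
  by rewrite mulr0n mul0rz mul0r addr0 mulr1n mulrA.
by rewrite mulr0n mul0rz addr0 mulr1n zQ -mulrDr mulrA.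
Qed.

Lemma coef_qpow i k P m : coef (qpow i k * P) m = coef P (m - unitv i *~ k).
Proof.
elim/intpow_ind: k P m => [|k IH|k IH] P m; first by rewrite mulr0z subr0 mul1r.
  by rewrite /qpow intpowS // -mulrA coefq IH mulrzDr mulr1z opprD addrA addrAC.
rewrite /qpow intpowP // -mulrA coefqi IH mulrzBr mulr1z opprB.
by rewrite addrA addrAC -addrA [- _ + _]addrC.
Qed.

Lemma coef_qmon k P m : coef (qmon k * P) m = coef P (m - k).
Proof.
rewrite /qmon -mulrA !coef_qpow -addrA -opprD; congr (coef P (m - _)).
have unitE (u v a b : int) : (u, v) + (a, b) = (u + a, v + b) by [].
have unitM (u v : int) l : (u, v) *~ l = (u *~ l, v *~ l).
  by rewrite [LHS]surjective_pairing !raddfMz.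
by rewrite !unitM !mul0rz !intz unitE addr0 add0r -surjective_pairing.
Qed.

(** Kept transparent, since its variables and its monomials at [(1, 0)] and [(0, 1)] are later
    identified with the generators by conversion. *)
Definition model_of_gens : qdiff_model A.
Proof.
refine (@QdiffModel K A z (d ord0) (d ord_max) qmon _ _ _ z_qmon _ _ _ qmonD _
  coef coefD coefZ coef1 coefz _ _ coef_qmon).
- by apply/commr_sym/zd.
- by apply/commr_sym/zd.
- exact: dd.
- by move=> m; rewrite d_qmon mulrzl.
- by move=> m; rewrite d_qmon mulrzl.
- by rewrite /qmon /qpow /= mulr1.
- move=> S S1 SD SZ Sz Sx Sy SQ; apply: A_ind => //.
  + by move=> i P SP; case: (unliftP ord0 i) => [j ->|->]; last exact: Sx;
      rewrite (ord1 j) (_ : lift _ _ = ord_max); [exact: Sy|exact/val_inj].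
  + move=> i P SP; have := SQ (unitv i) P SP; rewrite /qmon /unitv.
    case: (unliftP ord0 i) => [j ->|->] /=; last by rewrite /qpow /= expr1 mulr1.
    rewrite /qpow /= mul1r expr1 (ord1 j) (_ : lift _ _ = ord_max) //.
    exact/val_inj.
  + move=> i P SP; have := SQ (- unitv i) P SP; rewrite /qmon /unitv.
    case: (unliftP ord0 i) => [j ->|->] /=; last by rewrite /qpow /= expr1 mulr1.
    rewrite /qpow /= mul1r expr1 (ord1 j) (_ : lift _ _ = ord_max) //.
    exact/val_inj.
- by move=> P m; rewrite coefd.
- by move=> P m; rewrite coefd.
Defined.

End Build.

(** * The action of the free algebra on Laurent series *)

Section Action.
Variable K : fieldType.
Local Notation K3 := {poly {poly {poly K}}}.
Local Notation free_alg := {malg K[{fmonom gen}]}.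

(* [phi] stands for the Laurent series [\sum_m q^m (phi m)], on which the
   generators act by left multiplication. *)
Definition gen_act (g : gen) (phi : int * int -> K3) (m : int * int) : K3 :=
  match g with
  | Gz => 'X%:P%:P * phi m
  | Gq i => phi (m - unitv i)
  | Gqinv i => phi (m + unitv i)
  | Gzdelta i => (varp K i + (compv i m)%:~R * 'X%:P%:P) * phi m
  end.

Definition word_act (w : seq gen) phi := foldr gen_act phi w.

Definition const3 : {rmorphism K -> K3} := polyC \o polyC \o polyC.

Definition free_act (x : free_alg) phi m : K3 :=
  mmap const3 (fun w : {fmonom gen} => word_act w phi m) x.

(** Each generator acts by a multiplication in the commutative ring [K3] or by a translation of
    exponents, so words act [K3]-linearly. *)
Lemma word_act_sum (I : Type) (r : seq I) (a : I -> K3) phi w :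
  word_act w (fun m => \sum_(i <- r) a i * phi i m) =
  (fun m => \sum_(i <- r) a i * word_act w (phi i) m).
Proof.
elim: w => //= g w ->; apply/funext => m; case: g => [|i|i|i] //=.
  by rewrite mulr_sumr; apply: eq_bigr => i _; rewrite mulrCA.
by rewrite mulr_sumr; apply: eq_bigr => j _; rewrite mulrCA.
Qed.

Lemma free_actD x y phi m :
  free_act (x + y) phi m = free_act x phi m + free_act y phi m.
Proof. exact: mmapD. Qed.

Lemma free_actB x y phi m :
  free_act (x - y) phi m = free_act x phi m - free_act y phi m.
Proof. exact: mmapB. Qed.

Lemma free_actU c (w : {fmonom gen}) phi m :
  free_act << c *g w >> phi m = const3 c * word_act w phi m.
Proof. exact: mmapU. Qed.

Lemma free_actU1 (w : {fmonom gen}) phi m : free_act << w >> phi m = word_act w phi m.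
Proof. by rewrite free_actU rmorph1 mul1r. Qed.

(** Words multiply by concatenation, which acts by composition; [word_act_sum] moves a word through
    the inner sum. *)
Lemma free_actM x y phi : free_act (x * y) phi = free_act x (free_act y phi).
Proof.
apply/funext => m; rewrite {1}/free_act malgME raddf_sum.
apply: eq_bigr => v _; rewrite raddf_sum word_act_sum mulr_sumr.
apply: eq_bigr => w _.
rewrite [LHS]mmapU.
apply: etrans (congr1 ( *%R^~ _) (rmorphM const3 _ _)) _.
rewrite /= -mulrA; congr (_ * (_ * _)).
by rewrite fmM /word_act foldr_cat.
Qed.

Lemma free_act_gen g phi : free_act (fgen K g) phi = gen_act g phi.
Proof.
by apply/funext => m; rewrite free_actU1 fmU.
Qed.

Lemma free_actZ k x phi m : free_act (k *: x) phi m = const3 k * free_act x phi m.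
Proof.
rewrite /free_act (mmapEw (msuppZ_le _ _)) mmapE mulr_sumr.
apply: eq_bigr => w _; rewrite mcoeffZ.
apply: etrans (congr1 ( *%R^~ _) (rmorphM const3 _ _)) _.
by rewrite /= -mulrA.
Qed.

Lemma free_act1 phi : free_act 1 phi = phi.
Proof.
by apply/funext => m; rewrite free_actU1 fm1.
Qed.

Lemma free_act_gen2 g h phi :
  free_act (fgen K g * fgen K h) phi = gen_act g (gen_act h phi).
Proof. by rewrite free_actM (free_act_gen g) (free_act_gen h). Qed.

Lemma free_act_comm g h :
    (forall phi m, gen_act g (gen_act h phi) m = gen_act h (gen_act g phi) m) ->
  forall phi m, free_act (fgen K g * fgen K h - fgen K h * fgen K g) phi m = 0.
Proof.
move=> gh phi m; apply: etrans (free_actB _ _ _ _) _.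
apply/eqP; rewrite subr_eq0; apply/eqP.
apply: etrans (congr1 (fun f => f m) (free_act_gen2 g h phi)) _.
exact: etrans (gh phi m) (esym (congr1 (fun f => f m) (free_act_gen2 h g phi))).
Qed.

Lemma free_act_inv g h :
    (forall phi m, gen_act g (gen_act h phi) m = phi m) ->
  forall phi m, free_act (fgen K g * fgen K h - 1) phi m = 0.
Proof.
move=> gh phi m; apply: etrans (free_actB _ _ _ _) _.
apply/eqP; rewrite subr_eq0; apply/eqP.
apply: etrans (congr1 (fun f => f m) (free_act_gen2 g h phi)) _.
exact: etrans (gh phi m) (esym (congr1 (fun f => f m) (free_act1 phi))).
Qed.

(** The elements acting by zero form a two-sided ideal, so only the relators need checking; hence
    the action descends to the quotient. *)
Lemma free_act_rel x : x \in rel_ideal (K := K) -> forall phi m, free_act x phi m = 0.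
Proof.
move=> /rel_idealP;
apply: (@smallest_sub _ _ _ [set y | forall phi m, free_act y phi m = 0]).
  have act0 p : free_act p (fun=> 0) = fun=> 0.
    apply/funext => m; rewrite /free_act /mmap big1 // => w _.
    suff -> : word_act w (fun=> 0) = fun=> 0 by rewrite mulr0.
    elim: (w : seq gen) => //= g s ->; apply/funext => k.
    by case: g => //= *; rewrite mulr0.
  split; first split=> [phi m|y t /= y0 t0 phi m|p y /= y0 phi m].
  - exact: mmap0.
  - by rewrite free_actD y0 t0 addr0.
  - rewrite free_actM (_ : free_act y phi = fun=> 0) ?act0 //.
    exact/funext/y0.
  - by move=> p y /= y0 phi m; rewrite free_actM y0.
move=> _ [g|i j|i|i|i j|i j].
- apply: free_act_comm => phi m; case: g => //= i; first exact: mulrCA.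
- by apply: free_act_comm => phi m /=; rewrite addrAC.
- by apply: free_act_inv => phi m /=; rewrite subrK.
- by apply: free_act_inv => phi m /=; rewrite addrK.
- move=> phi m; apply: etrans (free_actB _ _ _ _) _.
  apply/eqP; rewrite subr_eq0; apply/eqP.
  apply: etrans (congr1 (fun f => f m) (free_act_gen2 (Gzdelta i) (Gq j) phi)) _.
  apply: esym; apply: etrans (free_actD _ _ _ _) _.
  have E1 := congr1 (fun f => f m) (free_act_gen2 (Gq j) (Gzdelta i) phi).
  have E2 := congr1 (fun f => f m) (free_act_gen2 Gz (Gq j) phi).
  have E3 : free_act ((i == j)%:R * (fgen K Gz * fgen K (Gq j))) phi m =
      (i == j)%:R * ('X%:P%:P * phi (m - unitv j)).
    case: (i == j); first by rewrite mul1r mul1r E2.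
    by rewrite mul0r mul0r; apply: mmap0.
  apply: etrans (congr2 +%R E1 E3) _; rewrite /=.
  (* Translation by [unitv j] changes the [i]-th component by the Kronecker symbol, which accounts
     for the term [z q_j]. *)
  have -> : compv i m = compv i (m - unitv j) + (i == j)%:R.
    rewrite /compv /unitv; case: (unliftP ord0 i) => [i' ->|->] /=;
      case: (unliftP ord0 j) => [j' ->|->] /=; rewrite ?(ord1 i') ?(ord1 j') /=;
      by rewrite ?eqxx /= ?subr0 ?subrK ?addr0.
  rewrite [in RHS]rmorphD /= rmorph_nat.
  move: (phi _) => t; move: (varp K i) => v; ring.
- apply: free_act_comm => phi m /=; exact: mulrCA.
Qed.

End Action.

(** * Coefficients on the presented algebra, and the colon ideal *)

Section DalgModel.
Variable K : numFieldType.
Local Notation K3 := {poly {poly {poly K}}}.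
Local Notation D := (Dalg K).

Lemma DpiM (x y : {malg K[{fmonom gen}]}) : Dpi x * Dpi y = Dpi (x * y).
Proof. exact: Dpi_mul. Qed.

Lemma DpiZ c (x : {malg K[{fmonom gen}]}) : c *: Dpi x = Dpi (c *: x).
Proof. exact: Dpi_scale. Qed.

Lemma Dpi_rel (x y : {malg K[{fmonom gen}]}) : relator (x - y) -> Dpi x = Dpi y.
Proof. by move=> r; apply/DpiP/rel_idealP; apply: sub_gen_smallest. Qed.

(** A representative of [P] acts on the series [1], supported at exponent 0; [Dcoef_pi] shows that
    the choice of representative does not matter. *)
Definition Dcoef (P : D) (m : int * int) : K3 :=
  free_act (repr P) (fun k => (k == 0)%:R) m.

Lemma Dcoef_pi x m : Dcoef (Dpi x) m = free_act x (fun k => (k == 0)%:R) m.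
Proof.
apply/eqP; rewrite -subr_eq0 -free_actB; apply/eqP; apply: free_act_rel.
by apply/DpiP; rewrite DpiK.
Qed.

Lemma DcoefD (P P' : D) m : Dcoef (P + P') m = Dcoef P m + Dcoef P' m.
Proof.
rewrite -(DpiK P) -(DpiK P').
exact: etrans (congr1 (Dcoef^~ m) (esym (raddfD _ _ _))) (etrans (Dcoef_pi _ _)
  (etrans (free_actD _ _ _ _) (esym (congr2 +%R (Dcoef_pi _ _) (Dcoef_pi _ _))))).
Qed.

Lemma DcoefZ k (P : D) m : Dcoef (k *: P) m = k%:P%:P%:P * Dcoef P m.
Proof.
rewrite -(DpiK P).
exact: etrans (congr1 (Dcoef^~ m) (DpiZ k _)) (etrans (Dcoef_pi _ _)
  (etrans (free_actZ _ _ _ _) (esym (congr1 ( *%R _) (Dcoef_pi _ _))))).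
Qed.

Lemma Dcoef1 m : Dcoef 1 m = (m == 0)%:R.
Proof.
exact: etrans (Dcoef_pi 1 m) (congr1 (fun f => f m) (free_act1 _)).
Qed.

Lemma Dcoef_gen g (P : D) m :
  Dcoef (Dpi (fgen K g) * P) m = gen_act g (Dcoef P) m.
Proof.
rewrite -(DpiK P).
have -> : Dcoef (Dpi (repr P)) = free_act (repr P) (fun k => (k == 0)%:R).
  by apply/funext => k; apply: Dcoef_pi.
apply: etrans (congr1 (Dcoef^~ m) (DpiM _ _)) (etrans (Dcoef_pi _ _) _).
by rewrite free_actM free_act_gen.
Qed.

Lemma Dalg_ind (S : D -> Prop) :
  S 1 -> (forall P P', S P -> S P' -> S (P + P')) ->
  (forall (k : K) P, S P -> S (k *: P)) ->
  (forall g P, S P -> S (Dpi (fgen K g) * P)) -> forall P, S P.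
Proof.
move=> S1 SD SZ Sg P; rewrite -(DpiK P).
have Sw (s : seq gen) (w : {fmonom gen}) : s = w :> seq gen -> S (Dpi << w >>).
  elim: s w => [|g s IH] w Ew.
    have -> : w = mone by apply/eqP; rewrite fmP fm1 -Ew.
    exact: S1.
  have -> : w = mmul (fmu g) (FMonom s) by apply/eqP; rewrite fmP fmM fmU -Ew.
  have := Sg g _ (IH (FMonom s) erefl); rewrite DpiM malgM_def fgmulUU mulr1.
  by [].
have S0 : S 0 by rewrite -(scale0r 1); apply: SZ.
rewrite [repr P]monalgE raddf_sum; apply: big_rec => // w x _ Sx.
apply: (SD _ _ _ Sx).
have -> : << (repr P)@_w *g w >> = (repr P)@_w *: << w >>.
  by apply/malgP => k; rewrite mcoeffZ !mcoeffU mulrnAr mulr1.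
by apply: eq_ind (SZ _ _ (Sw _ w erefl)) _ (DpiZ _ _).
Qed.

Lemma Dmodel_subproof : exists M : qdiff_model D,
  [/\ zM M = zD K, xM M = zdD K ord0, yM M = zdD K ord_max,
      QM M (1, 0) = qD K ord0 & QM M (0, 1) = qD K ord_max].
Proof.
have zC g : GRing.comm (zD K) (Dpi (fgen K g)).
  rewrite /GRing.comm; apply: etrans (DpiM _ _) (etrans _ (esym (DpiM _ _))).
  exact/Dpi_rel/rel_z_central.
have qq i j : GRing.comm (qD K i) (qD K j).
  rewrite /GRing.comm; apply: etrans (DpiM _ _) (etrans _ (esym (DpiM _ _))).
  exact/Dpi_rel/rel_q_comm.
have dd i j : GRing.comm (zdD K i) (zdD K j).
  rewrite /GRing.comm; apply: etrans (DpiM _ _) (etrans _ (esym (DpiM _ _))).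
  exact/Dpi_rel/rel_zdelta_comm.
have qqi i : qD K i * qinvD K i = 1.
  by apply: etrans (DpiM _ _) _; apply/Dpi_rel/rel_q_qinv.
have qiq i : qinvD K i * qD K i = 1.
  by apply: etrans (DpiM _ _) _; apply/Dpi_rel/rel_qinv_q.
have dq i j : zdD K i * qD K j = qD K j * zdD K i + (i == j)%:R * (zD K * qD K j).
  apply: etrans (DpiM _ _) _.
  apply: etrans (Dpi_rel (rel_zdelta_q K i j)) _.
  rewrite raddfD; apply: congr2; first exact: esym (DpiM _ _).
  rewrite (DpiM _ _) mulr_natl mulr_natl; exact: raddfMn.
have ind (S : D -> Prop) : S 1 -> (forall P P', S P -> S P' -> S (P + P')) ->
    (forall (k : K) P, S P -> S (k *: P)) ->
    (forall P, S P -> S (zD K * P)) -> (forall i P, S P -> S (zdD K i * P)) ->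
    (forall i P, S P -> S (qD K i * P)) -> (forall i P, S P -> S (qinvD K i * P)) ->
    forall P, S P.
  move=> S1 SD SZ Sz Sd Sq Sqi; apply: (Dalg_ind S1 SD SZ) => g P SP.
  by case: g => [|i|i|i]; [exact: Sz|exact: Sq|exact: Sqi|exact: Sd].
exists (model_of_gens (coef := Dcoef) (fun i => zC (Gq i)) (fun i => zC (Gzdelta i))
  qq qqi qiq dq dd ind DcoefD DcoefZ Dcoef1 (Dcoef_gen Gz)
  (fun i => Dcoef_gen (Gzdelta i)) (fun i => Dcoef_gen (Gq i))
  (fun i => Dcoef_gen (Gqinv i))).
split=> //; first by exact: (mulr1 (qD K ord0)).
exact: (mul1r (qD K ord_max)).
Qed.

Lemma GKZ_colon N B S (a b : int) :
    b = - B.+1%:Z -> a + b = S.+1%:Z ->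
  left_colon (GKZ_ideal K N.+2 a b) (ctop K a b) =
  left_ideal [set P0 K N.+2 a b; box_e K N.+2 a b; box_he K a b].
Proof.
move=> bE abE; have [M [zE xE yE q1E q2E]] := Dmodel_subproof.
have cE : ctop K a b = cM M B S by rewrite (cM_int M bE abE) xE yE.
have eE : box_e K N.+2 a b = boxeM M N B S.
  rewrite (boxeM_int M N bE abE) xE yE zE q1E.
  reflexivity.
have hE : box_he K a b = boxhM M B S.
  rewrite (boxhM_int M bE abE) xE yE zE q2E.
  reflexivity.
have pE : P0 K N.+2 a b = P0M M N B S.
  rewrite (P0M_int M N bE abE) xE yE zE q1E q2E.
  reflexivity.
rewrite /GKZ_ideal cE eE hE pE; exact: colonM.
Qed.

End DalgModel.

Theorem proposition6p5 (R : realType) (n : nat) (a b : int)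
  (hn : (2 <= n)%N)
  (hb : 1 - n%:Z <= b <= -1)
  (hab : a + b = 1 \/ a + b = 2) :
  left_colon (GKZ_ideal R[i] n a b) (ctop R[i] a b) =
  left_ideal [set P0 R[i] n a b; box_e R[i] n a b; box_he R[i] a b].
Proof.
(* The parameters are put in successor form: [N = n - 2], [B = - b - 1] and [S = a + b - 1]. *)
have [N ->] : exists N, n = N.+2 by exists n.-2; lia.
have [B bE] : exists B : nat, b = - B.+1%:Z by exists `|b|.-1; lia.
have [S abE] : exists S : nat, a + b = S.+1%:Z by exists `|a + b|.-1; lia.
exact: GKZ_colon bE abE.
Qed.
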